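(* Let $A$ be a commutative ring and let $m,n\geq 1$. Then the map $$\mathrm{Hom}^{\mathrm{c,alg}}_{A}\big(\mathcal L^n(A),\mathcal L^m(A)\big)\longrightarrow \mathbb H_{m,n}(A),\qquad \phi\longmapsto\big(\phi(t_1),\ldots,\phi(t_n)\big)$$ is well defined and is a bijection.
   Context: Rings are commutative, associative and unital. For $n\geq 1$, $\mathcal L^n(A)=A((t_1))\ldots((t_n))$ is the ring of iterated Laurent series (inductively $\mathcal L^1(A)=A((t_1))$, $\mathcal L^n(A)=\mathcal L^{n-1}(A)((t_n))$). Elements are written $f=\sum_{l\in\mathbb Z^n}a_lt^l$ with $t^l=t_1^{l_1}\cdots t_n^{l_n}$, and $\mathrm{supp}(f)=\{l: a_l\neq 0\}$. Put $\Lambda_1=\mathbb Z$, $\mathbb Z^1_\lambda=\{l\in\mathbb Z: l\geq\lambda\}$, and for $n\geq 2$ put $\Lambda_n=\mathrm{Map}(\mathbb Z,\Lambda_{n-1})\times\mathbb Z$ and $\mathbb Z^n_\lambda=\bigcup_{l_n\geq\lambda_n}\mathbb Z^{n-1}_{\lambda'(l_n)}\times\{l_n\}$ for $\lambda=(\lambda',\lambda_n)\in\Lambda_n$. A formal series lies in $\mathcal L^n(A)$ iff its support is contained in $\mathbb Z^n_\lambda$ for some $\lambda\in\Lambda_n$. Topology: $\mathcal L^n(A)$ is an additive topological group with a base of open neighborhoods of zero given by the $A$-submodules $U_\lambda=\{f:\mathrm{supp}(f)\cap(-\mathbb Z^n_\lambda)=\varnothing\}$, $\lambda\in\Lambda_n$.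 $\mathrm{Hom}^{\mathrm{c,alg}}_{A}(\mathcal L^n(A),\mathcal L^m(A))$ is the set of all continuous homomorphisms of $A$-algebras $\mathcal L^n(A)\to\mathcal L^m(A)$. $\underline{\mathbb Z}(A)$ is the ring of locally constant functions $\mathrm{Spec}(A)\to\mathbb Z$. The lexicographical order on $\mathbb Z^n$ compares the last coordinates first: $(l_1,\ldots,l_n)\leq(l_1',\ldots,l_n')$ iff $l_n<l'_n$, or $l_n=l_n'$ and $(l_1,\ldots,l_{n-1})\leq(l'_1,\ldots,l'_{n-1})$. For $f\in\mathcal L^n(A)^*$ it is known that there is a finite decomposition $A\simeq\prod_i A_i$ and elements $l_i\in\mathbb Z^n$ such that the component $\sum_l a_{i,l}t^l\in\mathcal L^n(A_i)$ of $f$ has $a_{i,l}$ nilpotent for all $l<l_i$ and $a_{i,l_i}$ invertible; then $\nu(f)\in\underline{\mathbb Z}(A)^n$ is the locally constant function with value $l_i$ on $\mathrm{Spec}(A_i)$, and $\nu:\mathcal L^n(A)^*\to\underline{\mathbb Z}(A)^n$ is a group homomorphism. Elements of $\underline{\mathbb Z}(A)^n$ are viewed as columns. $\mathrm M^+_{m\times n}(\mathbb Z)$ is the set of integral $(m\times n)$-matrices $(x_{ji})$ in column echelon form with positive leading entries: there are $1\leq p_1<\ldots<p_n\leq m$ with $x_{p_i,i}>0$ and $x_{j,i}=0$ for $j>p_i$, for all $1\leq i\leq n$. $\mathrm M^+_{m\times n}(\underline{\mathbb Z}(A))$ is the set of $(m\times n)$-matrices over $\underline{\mathbb Z}(A)$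 that lie in $\mathrm M^+_{m\times n}(\mathbb Z)$ at every point of $\mathrm{Spec}(A)$. $\mathbb H_{m,n}(A)\subset(\mathcal L^m(A)^* )^{\times n}$ is the set of all collections $(\varphi_1,\ldots,\varphi_n)$ of invertible elements of $\mathcal L^m(A)$ such that the matrix with columns $\nu(\varphi_1),\ldots,\nu(\varphi_n)$ belongs to $\mathrm M^+_{m\times n}(\underline{\mathbb Z}(A))$. *)

(* Defs.v *)
From HB Require Import structures.
From mathcomp Require Import all_boot all_order all_algebra.
From mathcomp Require Import boolp classical_sets functions cardinality fsbigop.
From mathcomp Require Import filter topology tvs.
From mathcomp Require Import zify.

Set Implicit Arguments.
Unset Strict Implicit.
Unset Printing Implicit Defensive.

Import Order.TTheory GRing.Theory Num.Theory.

Local Open Scope classical_set_scope.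
Local Open Scope ring_scope.

(* Rings are [comPzRingType]: the zero ring is allowed. *)

Definition invertible (R : comPzRingType) (x : R) : Prop := exists y, x * y = 1.

Definition nilpotent (R : comPzRingType) (x : R) : Prop := exists k, x ^+ k = 0.

Section Laurent.
Variable R : comPzRingType.
Implicit Types i j k N : int.

Record laurent := Laurent {
  lcoef :> int -> R;
  lcoefP : exists N, forall i, i < N -> lcoef i = 0 }.

HB.instance Definition _ := gen_eqMixin laurent.
HB.instance Definition _ := gen_choiceMixin laurent.

Lemma laurentP (f g : laurent) : (forall i, f i = g i) -> f = g.
Proof.
case: f g => f fP [g gP] /= fg; have e : f = g by apply: funext.
by case: _ / e gP => gP; congr Laurent; exact: Prop_irrelevance.
Qed.

Lemma laurent_zero_subproof : exists N, forall i, i < N -> (0 : R) = 0.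
Proof. by exists 0. Qed.

Lemma laurent_opp_subproof (f : laurent) :
  exists N, forall i, i < N -> - f i = 0.
Proof. by have [N fN] := lcoefP f; exists N => i /fN ->; rewrite oppr0. Qed.

Lemma laurent_add_subproof (f g : laurent) :
  exists N, forall i, i < N -> f i + g i = 0.
Proof.
have [N fN] := lcoefP f; have [M gM] := lcoefP g.
by exists (Num.min N M) => i; rewrite lt_min => /andP[/fN -> /gM ->]; rewrite addr0.
Qed.

Definition laurent_zero := Laurent laurent_zero_subproof.
Definition laurent_opp f := Laurent (laurent_opp_subproof f).
Definition laurent_add f g := Laurent (laurent_add_subproof f g).

Lemma laurent_addA : associative laurent_add.
Proof. by move=> f g h; apply: laurentP => i /=; rewrite addrA. Qed.
Lemma laurent_addC : commutative laurent_add.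
Proof. by move=> f g; apply: laurentP => i /=; rewrite addrC. Qed.
Lemma laurent_add0 : left_id laurent_zero laurent_add.
Proof. by move=> f; apply: laurentP => i /=; rewrite add0r. Qed.
Lemma laurent_addN : left_inverse laurent_zero laurent_opp laurent_add.
Proof. by move=> f; apply: laurentP => i /=; rewrite addNr. Qed.

HB.instance Definition _ := GRing.isZmodule.Build laurent
  laurent_addA laurent_addC laurent_add0 laurent_addN.

(* The sum has finitely many non-zero terms when f and g are bounded below. *)
Definition conv (f g : int -> R) k : R := \sum_(i \in [set: int]) f i * g (k - i).

Definition window a (n : nat) : seq int := [seq a + Posz p | p <- iota 0 n].

Lemma window_uniq a n : uniq (window a n).
Proof. by rewrite map_inj_uniq ?iota_uniq // => x y /addrI []. Qed.

Lemma mem_window a n i : (i \in window a n) = (a <= i < a + n%:Z).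
Proof.
apply/mapP/idP => [[p]|hi]; first by rewrite mem_iota => hp ->; lia.
by exists (absz (i - a)); [rewrite mem_iota; lia|lia].
Qed.

Lemma conv_window (f g : int -> R) a b w n k :
  (forall i, i < a -> f i = 0) -> (forall i, i < b -> g i = 0) ->
  w <= a -> k - b < w + n%:Z ->
  conv f g k = \sum_(i <- window w n) f i * g (k - i).
Proof.
move=> fa gb wa kw; rewrite /conv (fsbigE (window w n)) ?window_uniq //=.
- by apply: eq_bigl => i; rewrite in_setT.
move=> i _; rewrite mem_window => hi.
have [ia|ai] := ltP i a; first by rewrite fa ?mul0r.
by rewrite (gb (k - i)) ?mulr0 //; lia.
Qed.

Lemma conv0 (f g : int -> R) a b k :
  (forall i, i < a -> f i = 0) -> (forall i, i < b -> g i = 0) ->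
  k < a + b -> conv f g k = 0.
Proof.
move=> fa gb kab; rewrite (@conv_window _ _ a b a 0) ?big_nil //; lia.
Qed.

Lemma laurent_mul_subproof (f g : laurent) :
  exists N, forall i, i < N -> conv f g i = 0.
Proof.
have [a fa] := lcoefP f; have [b gb] := lcoefP g.
by exists (a + b) => i; apply: conv0.
Qed.

Definition laurent_mul f g := Laurent (laurent_mul_subproof f g).

Lemma laurent_const_subproof (c : R) :
  exists N, forall i, i < N -> (if i == 0 then c else 0) = 0.
Proof. by exists 0 => i i0; rewrite lt_eqF. Qed.

Definition laurent_const c := Laurent (laurent_const_subproof c).

Lemma laurent_var_subproof :
  exists N, forall i, i < N -> (if i == 1 then 1 else 0 : R) = 0.
Proof. by exists 1 => i i0; rewrite lt_eqF. Qed.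

Definition laurent_var := Laurent laurent_var_subproof.

Lemma laurent_mulC : commutative laurent_mul.
Proof.
move=> f g; apply: laurentP => k /=; rewrite /conv.
rewrite (reindex_fsbigT (fun i => k - i)); last first.
  by exists (fun i => k - i) => i; rewrite subKr.
by apply: eq_fsbigr => i _; rewrite subKr mulrC.
Qed.

Lemma laurent_mulDl : left_distributive laurent_mul laurent_add.
Proof.
move=> f g h; apply: laurentP => k /=.
have [a fa] := lcoefP f; have [b gb] := lcoefP g; have [c hc] := lcoefP h.
pose d := Num.min a b.
have fd i : i < d -> f i = 0 by move=> ?; apply: fa; lia.
have gd i : i < d -> g i = 0 by move=> ?; apply: gb; lia.
pose n := absz (k - c - d + 1).
rewrite !(@conv_window _ _ d c d n) //; try lia.
  by rewrite -big_split /=; apply: eq_bigr => i _; rewrite mulrDl.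
by move=> i hi; rewrite fd ?gd ?addr0.
Qed.

Lemma laurent_const_mulE c (f : laurent) k :
  laurent_mul (laurent_const c) f k = c * f k.
Proof.
rewrite /= /conv (fsbigE [:: 0]) //= => [|i _]; last first.
  by rewrite inE => /negPf ->; rewrite mul0r.
by rewrite big_cons big_nil in_setT eqxx subr0 addr0.
Qed.

Lemma laurent_mul1 : left_id (laurent_const 1) laurent_mul.
Proof. by move=> f; apply: laurentP => k; rewrite laurent_const_mulE mul1r. Qed.

Lemma laurent_mulA : associative laurent_mul.
Proof.
move=> f g h; apply: laurentP => k /=.
have [a fa] := lcoefP f; have [b gb] := lcoefP g; have [c hc] := lcoefP h.
pose M : int := Posz (absz k + absz a + absz b + absz c + 1).
pose n := absz (M + M).
have fgab i : i < a + b -> conv f g i = 0 by apply: conv0.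
have ghbc i : i < b + c -> conv g h i = 0 by apply: conv0.
rewrite (@conv_window f (conv g h) a (b + c) (- M) n) //; try lia.
rewrite (@conv_window (conv f g) h (a + b) c (- M) n) //; try lia.
transitivity (\sum_(i <- window (- M) n) \sum_(j <- window (- M) n)
    f i * (g (j - i) * h (k - j))).
  apply: eq_big_seq => i; rewrite mem_window => hi; rewrite -mulr_sumr.
  have [ia|ai] := ltP i a; first by rewrite fa ?mul0r.
  congr (_ * _); rewrite /conv (reindex_fsbigT (fun j => j - i)); last first.
    by exists (fun j => j + i) => j; rewrite ?subrK ?addrK.
  rewrite (fsbigE (window (- M) n)) ?window_uniq //=.
    apply: eq_big => j; first by rewrite in_setT.
    by move=> _; rewrite opprB addrA subrK.
  move=> j _; rewrite mem_window => hj.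
  have [jb|bj] := ltP (j - i) b; first by rewrite gb ?mul0r.
  by rewrite (hc (k - i - (j - i))) ?mulr0 //; lia.
rewrite exchange_big /=; apply: eq_big_seq => j; rewrite mem_window => hj.
have [jc|cj] := ltP (k - j) c.
  by rewrite hc ?mulr0 // big1 // => i _; rewrite !mulr0.
rewrite (@conv_window f g a b (- M) n) //; try lia.
by rewrite mulr_suml; apply: eq_bigr => i _; rewrite mulrA.
Qed.

HB.instance Definition _ := GRing.Zmodule_isComPzRing.Build laurent
  laurent_mulA laurent_mulC laurent_mul1 laurent_mulDl.

Lemma lcoef0 i : (0 : laurent) i = 0. Proof. by []. Qed.
Lemma lcoefN (f : laurent) i : (- f) i = - f i. Proof. by []. Qed.
Lemma lcoefD (f g : laurent) i : (f + g) i = f i + g i. Proof. by []. Qed.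
Lemma lcoefM (f g : laurent) k :
  (f * g) k = \sum_(i \in [set: int]) f i * g (k - i).
Proof. by []. Qed.
Lemma lcoef_constM c (f : laurent) k : (laurent_const c * f) k = c * f k.
Proof. exact: laurent_const_mulE. Qed.

Lemma laurent_const_zmod : zmod_morphism laurent_const.
Proof.
move=> x y; apply: laurentP => i; rewrite lcoefD lcoefN /=.
by case: eqP; rewrite ?subrr.
Qed.

Lemma laurent_const_monoid : monoid_morphism laurent_const.
Proof.
split=> // x y; apply: laurentP => i; rewrite lcoef_constM /=.
by case: eqP; rewrite ?mulr0.
Qed.

HB.instance Definition _ :=
  GRing.isZmodMorphism.Build R laurent laurent_const laurent_const_zmod.
HB.instance Definition _ :=
  GRing.isMonoidMorphism.Build R laurent laurent_const laurent_const_monoid.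

End Laurent.

Definition mindex (n : nat) := {ffun 'I_n -> int}.

Definition mlast n (l : mindex n.+1) : int := l ord_max.
Definition mfront n (l : mindex n.+1) : mindex n := [ffun i => l (lift ord_max i)].

(* The last coordinates are compared first. *)
Fixpoint lexle (n : nat) : mindex n -> mindex n -> bool :=
  if n is k.+1 then fun l l' =>
    (mlast l < mlast l') || ((mlast l == mlast l') && lexle (mfront l) (mfront l'))
  else fun _ _ => true.

Definition lexlt n (l l' : mindex n) : bool := lexle l l' && (l != l').

(* The recursions start at n = 0 with a point; for n = 1 they give
   Map(Z, pt) * Z = Z and {l | l >= lambda}. *)
Fixpoint Lambda (n : nat) : Type :=
  if n is k.+1 then ((int -> Lambda k) * int)%type else unit.

Fixpoint Zlam (n : nat) : Lambda n -> set (mindex n) :=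
  if n is k.+1 then fun lam =>
    [set l | lam.2 <= mlast l /\ Zlam (lam.1 (mlast l)) (mfront l)]
  else fun _ => setT.

Fixpoint lam_join (n : nat) : Lambda n -> Lambda n -> Lambda n :=
  if n is k.+1 then fun lam mu =>
    (fun i => lam_join (lam.1 i) (mu.1 i), Num.min lam.2 mu.2)
  else fun _ _ => tt.

Lemma Zlam_joinl n (lam mu : Lambda n) : Zlam lam `<=` Zlam (lam_join lam mu).
Proof.
elim: n lam mu => // n IH lam mu l /= [h1 h2].
by split; [rewrite ge_min h1|exact: IH].
Qed.

Lemma lam_joinC n (lam mu : Lambda n) : lam_join lam mu = lam_join mu lam.
Proof.
elim: n lam mu => // n IH lam mu /=; congr pair; last by rewrite minC.
by apply: funext => i.
Qed.

Lemma Zlam_joinr n (lam mu : Lambda n) : Zlam mu `<=` Zlam (lam_join lam mu).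
Proof. by rewrite lam_joinC; exact: Zlam_joinl. Qed.

Fixpoint lam0 (n : nat) : Lambda n :=
  if n is k.+1 then (fun=> lam0 k, 0) else tt.

Fixpoint itL (A : comPzRingType) (n : nat) : comPzRingType :=
  if n is k.+1 then laurent (itL A k) else A.

(* An alias of [itL A n] which also carries the A-module structure and the
   topology. *)
Definition itLaurent (A : comPzRingType) (n : nat) : Type := itL A n.

HB.instance Definition _ A n := GRing.ComPzRing.copy (itLaurent A n) (itL A n).

Section IteratedLaurent.
Variable A : comPzRingType.

Fixpoint itconst (n : nat) : A -> itLaurent A n :=
  match n return A -> itLaurent A n with
  | 0 => fun a => a
  | k.+1 => fun a => @laurent_const (itL A k) (itconst k a)
  end.

(* t_(i+1), for i : 'I_n *)
Fixpoint itvar (n : nat) : 'I_n -> itLaurent A n :=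
  match n return 'I_n -> itLaurent A n with
  | 0 => fun=> 1
  | k.+1 => fun i => if unlift ord_max i is Some j then @laurent_const (itL A k) (itvar j)
                     else laurent_var (itL A k)
  end.

(* The coefficient a_l of t^l *)
Fixpoint itcoef (n : nat) : itLaurent A n -> mindex n -> A :=
  match n return itLaurent A n -> mindex n -> A with
  | 0 => fun a _ => a
  | k.+1 => fun (f : laurent (itL A k)) l => @itcoef k (f (mlast l)) (mfront l)
  end.

Lemma itconst_zmod n : zmod_morphism (@itconst n).
Proof.
elim: n => [//|n IH] x y; rewrite /= IH.
exact: (raddfB (@laurent_const (itL A n))).
Qed.

Lemma itconst_monoid n : monoid_morphism (@itconst n).
Proof.
elim: n => [//|n [IH1 IHM]]; split=> [|x y] /=.
  by rewrite IH1; exact: (rmorph1 (@laurent_const (itL A n))).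
by rewrite IHM; exact: (rmorphM (@laurent_const (itL A n))).
Qed.

HB.instance Definition _ n :=
  GRing.isZmodMorphism.Build A (itLaurent A n) (@itconst n) (itconst_zmod n).
HB.instance Definition _ n :=
  GRing.isMonoidMorphism.Build A (itLaurent A n) (@itconst n) (itconst_monoid n).

Section Module.
Variable n : nat.

Definition itscale (a : A) (f : itLaurent A n) : itLaurent A n := itconst n a * f.

Lemma itscaleA a b f : itscale a (itscale b f) = itscale (a * b) f.
Proof. by rewrite /itscale mulrA rmorphM. Qed.
Lemma itscale1 : left_id 1 itscale.
Proof. by move=> f; rewrite /itscale rmorph1 mul1r. Qed.
Lemma itscaleDr : right_distributive itscale +%R.
Proof. by move=> a f g; rewrite /itscale mulrDr. Qed.
Lemma itscaleDl f : {morph itscale^~ f : a b / a + b}.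
Proof. by move=> a b; rewrite /itscale rmorphD mulrDl. Qed.

HB.instance Definition _ := GRing.Zmodule_isLmodule.Build A (itLaurent A n)
  itscaleA itscale1 itscaleDr itscaleDl.

End Module.

Lemma itscaleE n (a : A) (f : itLaurent A n) : a *: f = itconst n a * f.
Proof. by []. Qed.

Lemma itcoefP n (f g : itLaurent A n) : (forall l, itcoef f l = itcoef g l) -> f = g.
Proof.
elim: n f g => [f g /(_ [ffun=> 0]) //|n IH f g fg].
apply: laurentP => i; apply: IH => l.
pose l' : mindex n.+1 := [ffun j => if unlift ord_max j is Some k then l k else i].
have := fg l'; rewrite /= /mlast ffunE unlift_none.
suff -> : mfront l' = l by [].
by apply/ffunP => j; rewrite !ffunE liftK.
Qed.

Lemma itcoef0 n l : itcoef (0 : itLaurent A n) l = 0.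
Proof. by elim: n l => //= n IH l; apply: IH. Qed.

Lemma itcoefB n (f g : itLaurent A n) l :
  itcoef (f - g) l = itcoef f l - itcoef g l.
Proof. by elim: n f g l => //= n IH f g l; exact: IH. Qed.

Lemma itcoefN n (f : itLaurent A n) l : itcoef (- f) l = - itcoef f l.
Proof. by rewrite -sub0r itcoefB itcoef0 sub0r. Qed.

Lemma itcoefD n (f g : itLaurent A n) l :
  itcoef (f + g) l = itcoef f l + itcoef g l.
Proof. by rewrite -{1}[g]opprK itcoefB itcoefN opprK. Qed.

Lemma itcoefZ n (a : A) (f : itLaurent A n) l :
  itcoef (a *: f) l = a * itcoef f l.
Proof.
elim: n f l => // n IH f l; rewrite itscaleE.
have E := @lcoef_constM (itL A n) (itconst n a) f (mlast l).
transitivity (itcoef (itconst n a * (f : laurent (itL A n)) (mlast l)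
  : itLaurent A n) (mfront l)); last exact: IH.
exact: (congr1 (fun g : itLaurent A n => itcoef g (mfront l)) E).
Qed.

Definition supp n (f : itLaurent A n) : set (mindex n) := [set l | itcoef f l <> 0].

Lemma supp_itLaurentP n (a : mindex n -> A) :
  (exists f : itLaurent A n, forall l, itcoef f l = a l) <->
  exists lam : Lambda n, [set l | a l <> 0] `<=` Zlam lam.
Proof.
split.
  move=> [f fa]; suff [lam hlam] : exists lam, supp f `<=` Zlam lam.
    by exists lam => l /= al; apply: hlam; rewrite /supp /= fa.
  elim: n f {a fa} => [f|n IH f]; first by exists tt.
  have [N fN] := lcoefP (f : laurent (itL A n)).
  have /choice [mu hmu] := fun i => IH ((f : laurent (itL A n)) i).
  exists (mu, N) => l; rewrite /supp /= => fl; split; last exact: hmu.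
  by rewrite leNgt; apply/negP => /fN fl0; apply: fl; rewrite fl0 itcoef0.
elim: n a => [a _|n IH a [lam hlam]].
  exists (a [ffun=> 0]) => l /=; congr a.
  by apply/ffunP => -[].
pose ext i (l : mindex n) : mindex n.+1 :=
  [ffun j => if unlift ord_max j is Some k then l k else i].
have extl i l : mlast (ext i l) = i by rewrite /mlast ffunE unlift_none.
have extf i l : mfront (ext i l) = l by apply/ffunP => j; rewrite !ffunE liftK.
have /choice [f hf] : forall i, exists f : itLaurent A n,
    forall l, itcoef f l = a (ext i l).
  move=> i; apply: IH; exists (lam.1 i) => l /= /hlam [_].
  by rewrite extl extf.
have fP : exists N, forall i, i < N -> f i = 0 :> itL A n.
  exists lam.2 => i iN; apply: itcoefP => l; rewrite itcoef0 hf.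
  by apply: contrapT => /hlam []; rewrite extl leNgt iN.
exists (@Laurent (itL A n) f fP) => l /=; rewrite hf; congr a.
apply/ffunP => j; rewrite ffunE /mlast; case: unliftP => [k ->|-> //].
by rewrite ffunE.
Qed.

Definition Unbhs n (lam : Lambda n) : set (itLaurent A n) :=
  [set f | supp f `&` [set - l | l in Zlam lam] = set0].

Lemma UnbhsP n (lam : Lambda n) (f : itLaurent A n) :
  Unbhs lam f <-> forall l, Zlam lam l -> itcoef f (- l) = 0.
Proof.
split=> [U0 l lZ|f0].
  apply: contrapT => fl; suff : (set0 : set (mindex n)) (- l) by [].
  by rewrite -U0; split=> //; exists l.
by apply/seteqP; split=> // l [fl [l' /f0 fl' ll']]; apply: fl; rewrite -ll'.
Qed.

Lemma Unbhs0 n (lam : Lambda n) : Unbhs lam 0.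
Proof. by apply/UnbhsP => l _; rewrite itcoef0. Qed.

Lemma UnbhsB n (lam : Lambda n) f g : Unbhs lam f -> Unbhs lam g -> Unbhs lam (f - g).
Proof.
move=> /UnbhsP fU /UnbhsP gU; apply/UnbhsP => l lZ.
by rewrite itcoefB fU ?gU ?subrr.
Qed.

Lemma UnbhsD n (lam : Lambda n) f g : Unbhs lam f -> Unbhs lam g -> Unbhs lam (f + g).
Proof.
move=> fU gU; rewrite -[g]opprK; apply: UnbhsB => //.
by rewrite -sub0r; apply: UnbhsB => //; exact: Unbhs0.
Qed.

Lemma Unbhs_join n (lam mu : Lambda n) :
  Unbhs (lam_join lam mu) `<=` Unbhs lam `&` Unbhs mu.
Proof.
move=> f /UnbhsP fU; split; apply/UnbhsP => l lZ; apply: fU.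
  exact: Zlam_joinl.
exact: Zlam_joinr.
Qed.

Section Topology.
Variable n : nat.

Definition itnbhs (f : itLaurent A n) : set_system (itLaurent A n) :=
  [set V | exists lam : Lambda n, forall g, Unbhs lam g -> V (f + g)].

HB.instance Definition _ := hasNbhs.Build (itLaurent A n) itnbhs.

Lemma itnbhs_filter (f : itLaurent A n) : ProperFilter (nbhs f).
Proof.
split; first by case=> lam /(_ 0 (Unbhs0 lam)).
split; first by exists (lam0 n).
- move=> V W [lam Vlam] [mu Wmu]; exists (lam_join lam mu) => g /Unbhs_join [gl gm].
  by split; [exact: Vlam|exact: Wmu].
- by move=> V W VW [lam Vlam]; exists lam => g /Vlam /VW.
Qed.

Lemma itnbhs_singleton (f : itLaurent A n) V : nbhs f V -> V f.
Proof. by case=> lam /(_ 0 (Unbhs0 lam)); rewrite addr0. Qed.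

Lemma itnbhs_nbhs (f : itLaurent A n) V : nbhs f V -> nbhs f (nbhs^~ V).
Proof.
case=> lam Vlam; exists lam => g gU; exists lam => h hU.
by rewrite -addrA; apply: Vlam; exact: UnbhsD.
Qed.

HB.instance Definition _ := Nbhs_isNbhsTopological.Build (itLaurent A n)
  itnbhs_filter itnbhs_singleton itnbhs_nbhs.

Lemma nbhs_itLaurentP (f : itLaurent A n) V :
  nbhs f V <-> exists lam : Lambda n, forall g, Unbhs lam g -> V (f + g).
Proof. by []. Qed.

Lemma itsub_continuous :
  continuous (fun x : itLaurent A n * itLaurent A n => x.1 - x.2).
Proof.
move=> [f g] V [lam Vlam].
exists ([set f + u | u in Unbhs lam], [set g + u | u in Unbhs lam]).
  by split; exists lam => u uU; exists u.
move=> [x y] [[u uU /= <-] [v vU /= <-]] /=.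
by rewrite opprD addrACA; apply: Vlam; exact: UnbhsB.
Qed.

HB.instance Definition _ :=
  PreTopologicalNmodule_isTopologicalZmodule.Build (itLaurent A n) itsub_continuous.

Lemma open_Unbhs (lam : Lambda n) : open (Unbhs lam).
Proof. by rewrite openE => f fU; exists lam => g gU; exact: UnbhsD. Qed.

End Topology.
End IteratedLaurent.

Definition HomCAlg (A : comPzRingType) (n m : nat) :
    set (itLaurent A n -> itLaurent A m) :=
  [set phi : itLaurent A n -> itLaurent A m |
     [/\ linear phi, monoid_morphism phi & continuous phi]].

Arguments HomCAlg : clear implicits.

Section Spec.
Variable A : comPzRingType.

Definition prime_ideal (P : A -> Prop) : Prop :=
  [/\ P 0, forall x y, P x -> P y -> P (x + y), forall a x, P x -> P (a * x),
      ~ P 1 & forall x y, P (x * y) -> P x \/ P y].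

Record Spec := MkSpec { spec_set :> A -> Prop; specP : prime_ideal spec_set }.

HB.instance Definition _ := gen_eqMixin Spec.
HB.instance Definition _ := gen_choiceMixin Spec.

Lemma spec1 (p : Spec) : ~ p 1. Proof. by case: (specP p). Qed.
Lemma specMl (p : Spec) a x : p x -> p (a * x).
Proof. by case: (specP p) => _ _ h _ _; exact: h. Qed.
Lemma specM (p : Spec) x y : p (x * y) -> p x \/ p y.
Proof. by case: (specP p) => _ _ _ _; exact. Qed.

(* The Zariski topology, with base the sets D(a) = {q | a \notin q} *)
Definition spec_nbhs (p : Spec) : set_system Spec :=
  [set V | exists2 a, ~ p a & forall q : Spec, ~ q a -> V q].

HB.instance Definition _ := hasNbhs.Build Spec spec_nbhs.

Lemma spec_nbhs_filter (p : Spec) : ProperFilter (nbhs p).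
Proof.
split; first by case=> a pa /(_ _ pa).
split; first by exists 1 => //; exact: spec1.
- move=> V W [a pa Va] [b pb Wb]; exists (a * b) => [/specM []//|q qab].
  split; [apply: Va|apply: Wb] => qx; apply: qab; last exact: specMl.
  by rewrite mulrC; exact: specMl.
- by move=> V W VW [a pa Va]; exists a => // q /Va /VW.
Qed.

Lemma spec_nbhs_singleton (p : Spec) V : nbhs p V -> V p.
Proof. by case=> a pa; apply. Qed.

Lemma spec_nbhs_nbhs (p : Spec) V : nbhs p V -> nbhs p (nbhs^~ V).
Proof. by case=> a pa Va; exists a => // q qa; exists a. Qed.

HB.instance Definition _ := Nbhs_isNbhsTopological.Build Spec
  spec_nbhs_filter spec_nbhs_singleton spec_nbhs_nbhs.

Definition locally_constant (v : Spec -> int) : Prop :=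
  forall p : Spec, \forall q \near p, v q = v p.

Record Zloc := MkZloc { zloc_fun :> Spec -> int; zlocP : locally_constant zloc_fun }.

HB.instance Definition _ := gen_eqMixin Zloc.
HB.instance Definition _ := gen_choiceMixin Zloc.

Lemma zloc_cst_subproof (k : int) : locally_constant (fun=> k).
Proof. by move=> p; exists 1 => //; exact: spec1. Qed.

Definition zloc_cst k := MkZloc (zloc_cst_subproof k).

End Spec.

Lemma Spec_map_subproof (A B : comPzRingType) (h : {rmorphism A -> B}) (q : Spec B) :
  prime_ideal (h @^-1` q).
Proof.
case: (specP q) => q0 qD qM q1 qP; split=> /=.
- by rewrite rmorph0.
- by move=> x y; rewrite rmorphD; exact: qD.
- by move=> a x; rewrite rmorphM; exact: qM.
- by rewrite rmorph1.
- by move=> x y; rewrite rmorphM; exact: qP.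
Qed.

Definition Spec_map (A B : comPzRingType) (h : {rmorphism A -> B}) (q : Spec B) :
  Spec A := MkSpec (Spec_map_subproof h q).

(* The family pi of projections encodes an isomorphism A ~ \prod_i B i, under
   which Spec (B i) is the part of Spec A given by the image of Spec_map (pi i). *)
Definition is_nu (A : comPzRingType) (n : nat) (f : itLaurent A n)
    (v : 'cV[Zloc A]_n) : Prop :=
  exists (k : nat) (B : 'I_k -> comPzRingType)
         (pi : forall i, {rmorphism A -> B i}) (l : 'I_k -> mindex n),
    [/\ bijective (fun (a : A) (i : 'I_k) => pi i a),
        forall i l', lexlt l' (l i) -> nilpotent (pi i (itcoef f l')),
        forall i, invertible (pi i (itcoef f (l i))) &
        forall i (q : Spec (B i)) j, v j 0 (Spec_map (pi i) q) = l i j].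

(* For invertible f there is exactly one v with is_nu f v; for other f the
   value of nu is irrelevant. *)
Definition nu (A : comPzRingType) (n : nat) (f : itLaurent A n) : 'cV[Zloc A]_n :=
  xget (const_mx (zloc_cst A 0)) [set v | is_nu f v].

Definition Mplus_int (m n : nat) (x : 'M[int]_(m, n)) : Prop :=
  exists p : 'I_n -> 'I_m,
    [/\ forall i i' : 'I_n, (i < i')%N -> (p i < p i')%N,
        forall i, 0 < x (p i) i &
        forall i (j : 'I_m), (p i < j)%N -> x j i = 0].

Definition Mplus (A : comPzRingType) (m n : nat) (x : 'M[Zloc A]_(m, n)) : Prop :=
  forall p : Spec A, Mplus_int (map_mx (fun v : Zloc A => v p) x).

Definition Hmn (A : comPzRingType) (m n : nat) : set ('I_n -> itLaurent A m) :=
  [set phi | (forall i, invertible (phi i)) /\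
             Mplus (\matrix_(j < m, i < n) nu (phi i) j 0)].

Arguments Hmn : clear implicits.

(* Main.v *)
Require Import Defs.
From HB Require Import structures.
From mathcomp Require Import all_boot all_order all_algebra.
From mathcomp Require Import boolp classical_sets functions cardinality fsbigop.
From mathcomp Require Import filter topology tvs.
From mathcomp Require Import zify ring.

Set Implicit Arguments.
Unset Strict Implicit.
Unset Printing Implicit Defensive.

Import Order.TTheory GRing.Theory Num.Theory.

Local Open Scope classical_set_scope.
Local Open Scope ring_scope.

(* A continuous homomorphism is determined by the images phi_i of the t_i, since
   the monomials span a dense subspace.  At a prime p of A the leading exponent
   of the image of t^w is additive in w, and because the powers t^(k w) tend to
   zero exactly when w is lexicographically positive, continuity forces this
   map Z^n -> Z^m to be strictly increasing for the lexicographical order, which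
   is the echelon condition.  Conversely, locally on Spec A (where idempotents
   of L^m(A) come from A) an element phi_i of exponent d in t_m is
   t_m^d c_i (1 + tau_i) with c_i a unit of L^(m-1)(A) and tau_i topologically
   nilpotent for t_m.  The coefficients of all products of powers of the
   1 + tau_i lie, in each degree, in one finitely generated additive group, so
   the family phi^l inherits its convergence from the family c^l by induction
   on m, and f |-> sum_l f_l phi^l is the required homomorphism. *)

(** * Primes, nilpotents and idempotents *)

(** Multiplication of an iterated Laurent ring is in general only separately continuous, so a family
    that tends to zero cannot simply be multiplied by another varying family. Finite generation in
    each degree removes the obstacle: an open subgroup containing the products with finitely many
    generators contains the products with everything they span, which leaves finitely many fixed
    multipliers.

    The passage from local to global uses no localisation. The scalars [a] for which a claim holds
    after multiplication by [a] form an ideal, and an ideal contained in no prime contains 1. The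
    same principle yields the finite decompositions of [A] required by [nu].

    Strict monotonicity becomes the echelon condition by testing it on vectors
    [mdelta i' - mdelta i *+ N] with [i < i'] and [N] large: they are positive for every [N], which
    forces the pivot of column [i'] below that of column [i]. *)

Section CommutativeAlgebra.
Variable R : comPzRingType.
Implicit Types (a b x y : R) (p : Spec R).

Lemma spec0 p : p 0. Proof. by case: (specP p). Qed.
Lemma specD p x y : p x -> p y -> p (x + y).
Proof. by case: (specP p) => _ h _ _ _; exact: h. Qed.
Lemma specMr p x y : p x -> p (x * y).
Proof. by move=> px; rewrite mulrC; exact: specMl. Qed.
Lemma specN p x : p x -> p (- x).
Proof. by rewrite -mulN1r; exact: specMl. Qed.
Lemma specB p x y : p x -> p y -> p (x - y).
Proof. by move=> px /specN; exact: specD. Qed.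
Lemma specBK p x y : p (x - y) -> p y -> p x.
Proof. by move=> pxy py; rewrite -(subrK y x); exact: specD. Qed.
Lemma specBr p x y : p (x - y) -> p x -> p y.
Proof. by move=> pxy px; rewrite -(subKr x y); exact: specB. Qed.
Lemma specX p x k : p (x ^+ k) -> p x.
Proof. by elim: k => [/spec1//|k IH]; rewrite exprS => /specM[]. Qed.
Lemma spec_sum p (I : eqType) (s : seq I) (F : I -> R) :
  (forall i, i \in s -> p (F i)) -> p (\sum_(i <- s) F i).
Proof.
move=> pF; rewrite big_seq; apply: (big_ind p); [exact: spec0|exact: specD|exact: pF].
Qed.

Definition is_ideal (J : R -> Prop) :=
  [/\ J 0, forall a b, J a -> J b -> J (a + b) & forall r a, J a -> J (r * a)].

(** Zorn's lemma gives an ideal that is maximal among those containing [J] and missing all powers of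
    [x]; maximality makes it prime. *)
Lemma prime_avoiding (J : R -> Prop) x : is_ideal J -> (forall k, ~ J (x ^+ k)) ->
  exists p, (forall a, J a -> p a) /\ ~ p x.
Proof.
move=> [J0 JD JM] Jx.
(* The last clause asks for [J] only inside a nonempty [K], so that the union of the empty chain is
   admissible. A maximal [K] is nonempty, since otherwise [J] would be larger. *)
pose P : set (set R) := [set K : set R | [/\ forall a b, K a -> K b -> K (a + b),
  forall r a, K a -> K (r * a), forall k, ~ K (x ^+ k) &
  forall b, K b -> forall a, J a -> K a]].
have chainP (F : set (set R)) : F `<=` P -> total_on F subset ->
    P (\bigcup_(X in F) X).
  move=> FP Ftot; split.
  - move=> a b [X FX Xa] [Y FY Yb]; have [XY|YX] := Ftot _ _ FX FY.
      by exists Y => //; have [YD _ _ _] := FP _ FY; apply: YD => //; exact: XY.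
    by exists X => //; have [XD _ _ _] := FP _ FX; apply: XD => //; exact: YX.
  - by move=> r a [X FX Xa]; exists X => //; have [_ XM _ _] := FP _ FX; exact: XM.
  - by move=> k [X FX]; have [_ _ Xx _] := FP _ FX; exact: Xx.
  - by move=> b [X FX Xb] a Ja; exists X => //; have [_ _ _ XJ] := FP _ FX; exact: XJ _ Xb _ Ja.
have [K [PK Kmax]] := Zorn_bigcup chainP; have [KD KM Kx KJ] := PK.
have K0 : K 0.
  apply: contrapT => nK0; apply: (Kmax J); last by split.
  by split=> [a Ka|JK]; [case: nK0; exact: KJ _ Ka _ J0|exact: nK0 (JK _ J0)].
have meets a : ~ K a -> exists k r, K (x ^+ k - r * a).
  move=> nKa; apply: contrapT => nk.
  apply: (Kmax [set b | exists r, K (b - r * a)]).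
    split=> [b Kb|JK]; first by exists 0; rewrite mul0r subr0.
    by apply: nKa; apply: JK; exists 1; rewrite mul1r subrr.
  split.
  - move=> b c [r Kr] [s Ks]; exists (r + s).
    by rewrite mulrDl opprD addrACA; exact: KD.
  - by move=> r b [s Ks]; exists (r * s); rewrite -mulrA -mulrBr; exact: KM.
  - by move=> k [r Kr]; apply: nk; exists k, r.
  - by move=> _ _ b Jb; exists 0; rewrite mul0r subr0; exact: KJ _ K0 _ Jb.
have Kp : prime_ideal K.
  split=> //; first exact: (Kx 0%N).
  move=> a b Kab; apply: contrapT => /not_orP[/meets[i [r Kr]] /meets[j [s Ks]]].
  apply: (Kx (i + j)%N); rewrite exprD.
  have -> : x ^+ i * x ^+ j = x ^+ j * (x ^+ i - r * a) + (r * a) * (x ^+ j - s * b)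
      + (r * s) * (a * b) by ring.
  by apply: (KD); [apply: (KD)|]; apply: (KM).
exists (MkSpec Kp); split=> /= [a|]; first exact: KJ _ K0 _.
by rewrite -[x]expr1.
Qed.

Lemma nilpotentP x : nilpotent x <-> forall p, p x.
Proof.
split=> [[k xk] p|px]; first by apply: (@specX p x k); rewrite xk; exact: spec0.
apply: contrapT => nx.
have [| |p [_ /(_ (px p))]] := @prime_avoiding (eq^~ 0) x => //.
  by split=> // [a b -> ->|r a ->]; rewrite ?addr0 ?mulr0.
by move=> k xk; apply: nx; exists k.
Qed.

(** The local-to-global tool: with [J] the scalars after multiplication by which a claim holds, a
    proof near each prime gives the claim itself. *)
Lemma ideal_one (J : R -> Prop) : is_ideal J -> (forall p, exists2 a, J a & ~ p a) -> J 1.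
Proof.
move=> JI Jp; apply: contrapT => nJ1.
have [k|p [Jp' _]] := @prime_avoiding J 1 JI; first by rewrite expr1n.
by have [a /Jp'] := Jp p.
Qed.

Lemma nilpotent_sum (I : eqType) (s : seq I) (F : I -> R) :
  (forall i, i \in s -> nilpotent (F i)) -> nilpotent (\sum_(i <- s) F i).
Proof.
by move=> nF; apply/nilpotentP => p; apply: spec_sum => i /nF /nilpotentP.
Qed.

Definition idem x := x * x = x.

Lemma idemC x : idem x -> idem (1 - x).
Proof.
rewrite /idem => ex; have -> : (1 - x) * (1 - x) = 1 - x - x + x * x by ring.
by rewrite ex subrK.
Qed.

Lemma idemM x y : idem x -> idem y -> idem (x * y).
Proof. by rewrite /idem => ex ey; rewrite mulrACA ex ey. Qed.

Lemma idemX x k : idem x -> x ^+ k.+1 = x.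
Proof. by move=> ex; elim: k => [|k IH]; rewrite ?expr1 // exprS IH. Qed.

(** The powers [x ^+ N.+1] and [(1 - x) ^+ N.+1] have product zero and generate the unit ideal, so
    the two summands of a resulting decomposition of 1 are orthogonal idempotents. The spare factor
    in [N.+1] gives the two factorisations, which locate [e]: a prime avoids [e] exactly when it
    contains [1 - x]. *)
Lemma idem_lift x : nilpotent (x * (1 - x)) ->
  exists e y z, [/\ idem e, e = x * y & 1 - e = (1 - x) * z].
Proof.
move=> [N xN].
have [y [z yz]] : exists y z, 1 = x ^+ N.+1 * y + (1 - x) ^+ N.+1 * z.
  apply: (@ideal_one (fun a => exists y z, a = x ^+ N.+1 * y + (1 - x) ^+ N.+1 * z)).
    split; first by exists 0, 0; rewrite !mulr0 addr0.
    - by move=> a b [y [z ->]] [y' [z' ->]]; exists (y + y'), (z + z'); ring.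
    - by move=> r a [y [z ->]]; exists (r * y), (r * z); ring.
  move=> p; have [px|npx] := pselect (p x); last first.
    exists (x ^+ N.+1); last by move/specX.
    by exists 1, 0; ring.
  exists ((1 - x) ^+ N.+1); first by exists 0, 1; ring.
  by move/specX => /specD /(_ px); rewrite subrK; exact: spec1.
have ee : x ^+ N.+1 * y * ((1 - x) ^+ N.+1 * z) = 0.
  by rewrite mulrACA -exprMn exprS xN mulr0 mul0r.
exists (x ^+ N.+1 * y), (x ^+ N * y), ((1 - x) ^+ N * z); split.
- by rewrite /idem -[RHS]mulr1 [in RHS]yz mulrDr ee addr0.
- by rewrite exprS mulrA.
- by rewrite {1}yz addrC addKr exprS mulrA.
Qed.

End CommutativeAlgebra.

(** * Laurent series in one variable *)

Section OneVariable.
Variable R : comPzRingType.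
Implicit Types (f g h : laurent R) (c d : R) (p : Spec R) (i j k N : int).

Lemma lcoefB f g i : (f - g) i = f i - g i. Proof. by []. Qed.
Lemma lcoef1 i : (1 : laurent R) i = if i == 0 then 1 else 0. Proof. by []. Qed.

Lemma lcoef_sum (I : Type) (s : seq I) (P : pred I) (F : I -> laurent R) i :
  (\sum_(x <- s | P x) F x) i = \sum_(x <- s | P x) F x i.
Proof. by elim/big_rec2: _ => // x y z _ <-. Qed.

Lemma laurent_mono_subproof c k :
  exists N, forall i, i < N -> (if i == k then c else 0) = 0.
Proof. by exists k => i ik; rewrite lt_eqF. Qed.

Definition mono c k := Laurent (laurent_mono_subproof c k).

Lemma mono_const c : mono c 0 = laurent_const c. Proof. exact: laurentP. Qed.
Lemma mono_var : mono 1 1 = laurent_var R. Proof. exact: laurentP. Qed.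
Lemma mono1 : mono 1 0 = 1. Proof. exact: laurentP. Qed.

Lemma lcoef_monoM c k f i : (mono c k * f) i = c * f (i - k).
Proof.
rewrite lcoefM (fsbigE [:: k]) //= => [|j _]; last first.
  by rewrite inE => /negPf ->; rewrite mul0r.
by rewrite big_cons big_nil in_setT eqxx addr0.
Qed.

Lemma monoM c d k j : mono c k * mono d j = mono (c * d) (k + j).
Proof.
apply: laurentP => i; rewrite lcoef_monoM /= subr_eq addrC.
by case: eqP; rewrite ?mulr0.
Qed.

Lemma monoX c k n : mono c k ^+ n = mono (c ^+ n) (k *+ n).
Proof. by elim: n => [|n IH]; rewrite ?mono1 // !exprS IH monoM mulrS. Qed.

Definition below (f : laurent R) N := forall i, i < N -> f i = 0.

Lemma belowP f : exists N, below f N. Proof. exact: lcoefP. Qed.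

Lemma below_le f N M : (M <= N) -> below f N -> below f M.
Proof. by move=> MN fN i iM; apply: fN; lia. Qed.

Lemma belowM f g N M : below f N -> below g M -> below (f * g) (N + M).
Proof. by move=> fN gM i iNM; exact: (@conv0 R f g N M). Qed.

Lemma belowX f N n : below f N -> below (f ^+ n) (N *+ n).
Proof.
move=> fN; elim: n => [|n IH]; last by rewrite exprS mulrS; exact: belowM.
by move=> i i0; rewrite expr0 lcoef1 lt_eqF.
Qed.

Lemma below_sum (I : Type) (s : seq I) (P : pred I) (F : I -> laurent R) N :
  (forall x, P x -> below (F x) N) -> below (\sum_(x <- s | P x) F x) N.
Proof.
by move=> FN i iN; rewrite lcoef_sum big1 // => x Px; exact: (FN x).
Qed.

Lemma lcoefM_window f g N M w n k : below f N -> below g M ->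
  w <= N -> k - M < w + n%:Z ->
  (f * g) k = \sum_(i <- window w n) f i * g (k - i).
Proof. exact: conv_window. Qed.

Lemma lcoefM_spec p f g k i0 : (forall i, i != i0 -> p (f i * g (k - i))) ->
  p ((f * g) k - f i0 * g (k - i0)).
Proof.
move=> fg; have [N fN] := belowP f; have [M gM] := belowP g.
pose w := Num.min N i0; pose n := absz (`|k - M - w| + `|i0 - w| + 1).
rewrite (lcoefM_window (w := w) (n := n) fN gM); try lia.
rewrite (bigD1_seq i0) ?window_uniq //=; last by rewrite mem_window; lia.
by rewrite addrAC subrr add0r -big_filter; apply: spec_sum => i; rewrite mem_filter => /andP[/fg].
Qed.

Definition spec_below p f N := forall i, i < N -> p (f i).

Lemma spec_belowM p f g N M : spec_below p f N -> spec_below p g M ->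
  p ((f * g) (N + M) - f N * g M).
Proof.
move=> fN gM; have -> : g M = g (N + M - N) by congr (_ _); lia.
apply: lcoefM_spec => i iN; have [/fN|Ni] := ltP i N; first exact: specMr.
by apply/specMl/gM; lia.
Qed.

Lemma spec_belowM_lt p f g N M : spec_below p f N -> spec_below p g M ->
  spec_below p (f * g) (N + M).
Proof.
(* Lowering the bound of [f] to [N'] makes [i] the boundary degree, where the product is congruent
   to [f N' * g M], and [f N'] already lies in [p]. *)
move=> fN gM i iNM; pose N' := i - M.
have fN' : p (f N') by apply: fN; rewrite /N'; lia.
have h : spec_below p f N' by move=> j jN; apply: fN; rewrite /N' in jN; lia.
have := spec_belowM h gM; rewrite subrK => /specBK; apply; exact: specMr.
Qed.

Lemma spec_lowest p f : (exists i, ~ p (f i)) -> exists k, ~ p (f k) /\ spec_below p f k.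
Proof.
move=> [i pfi]; have [N fN] := belowP f.
have Ni : N <= i by rewrite leNgt; apply/negP => /fN fi; apply: pfi; rewrite fi; exact: spec0.
have /ex_minnP[n /asboolP pn nmin] : exists n : nat, `[< ~ p (f (N + n%:Z)) >].
  by exists (absz (i - N)); apply/asboolP; have -> : N + `|i - N|%N%:Z = i by lia.
exists (N + n%:Z); split=> // j jn; apply: contrapT => pj.
have Nj : N <= j by rewrite leNgt; apply/negP => /fN fj; apply: pj; rewrite fj; exact: spec0.
have := nmin (absz (j - N)); suff -> : N + `|j - N|%N%:Z = j.
  by move=> /(_ (asboolT pj)); lia.
lia.
Qed.

(** Modulo [p] the coefficients lie in a domain, so the lowest terms of [f] and [g] multiply to the
    lowest term of the product, which is 1. *)
Lemma unit_lowest p f g : f * g = 1 -> exists k,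
  [/\ spec_below p f k, spec_below p g (- k), p (f k * g (- k) - 1) & ~ p (f k)].
Proof.
have ex f' g' : f' * g' = 1 -> exists i, ~ p (f' i).
  move=> fg; apply: contrapT => nf.
  have pf i : p (f' i) by apply: contrapT => h; apply: nf; exists i.
  have := @lcoefM_spec p f' g' 0 0 (fun i _ => specMr _ (pf i)).
  by rewrite fg => /specBK/(_ (specMr _ (pf 0))); exact: spec1.
move=> fg; have [k [pk fk]] := spec_lowest (ex _ _ fg).
have [k' [pk' gk']] := spec_lowest (ex g f (etrans (mulrC _ _) fg)).
have := spec_belowM fk gk'; rewrite fg lcoef1; case: eqP => [kk|_] hp; last first.
  by move/specN: hp; rewrite sub0r opprK => /specM[].
have kE : k' = - k by lia.
by exists k; rewrite -kE; split=> //; rewrite -opprB; exact: specN.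
Qed.

(** The topologically nilpotent series for the variable: by [topnilX] their powers eventually start
    in arbitrarily high degree. *)
Definition topnil f := forall i, i <= 0 -> nilpotent (f i).

Lemma topnil_split f : topnil f -> exists a b, [/\ f = a + b, nilpotent a & below b 1].
Proof.
move=> fn; have [N [N0 fN]] : exists N, N <= 0 /\ below f N.
  by have [N fN] := belowP f; exists (Num.min N 0); split; [|apply: below_le fN]; lia.
pose a := \sum_(i <- window N (absz (N - 1))) mono (f i) i.
have aE i : i <= 0 -> a i = f i.
  move=> i0; rewrite /a lcoef_sum; have [iN|Ni] := ltP i N.
    rewrite fN // big1_seq //= => j; rewrite mem_window => /andP[Nj _].
    by rewrite /mono /= lt_eqF //; lia.
  rewrite (bigD1_seq i) ?window_uniq //=; last by rewrite mem_window; lia.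
  by rewrite eqxx big1 ?addr0 // => j ji; rewrite eq_sym (negPf ji).
exists a, (f - a); split; first by rewrite addrC subrK.
- apply: nilpotent_sum => i; rewrite mem_window => hi.
  have [n fin] : nilpotent (f i) by apply: fn; lia.
  by exists n; rewrite monoX fin; apply: laurentP => j /=; case: eqP.
- by move=> i i1; rewrite lcoefB aE ?subrr //; lia.
Qed.

(** In the binomial expansion of [(a + b) ^+ k], with [a] nilpotent and [b] starting in degree at
    least 1, the terms with a high power of [a] vanish. The others contain a power of [b] close to
    [k], while the poles contributed by [a] stay bounded. *)
Lemma topnilX f : topnil f -> forall M, exists K, forall k : nat, (K <= k)%N -> below (f ^+ k) M.
Proof.
move=> /topnil_split[a [b [-> [s as0] b1]]] M; have [D0 aD0] := belowP a.
have [D aD] : exists D : nat, below a (- D%:Z).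
  by exists (absz D0); apply: below_le aD0; lia.
(* The summand [s * D] pays for the poles of [a ^+ (k - i)] with [k - i < s], the summand [s] for
   the factors [b] that these terms lack, and [absz M] reaches the target. *)
exists (absz M + s * D + s)%N => k Kk; rewrite exprDn_comm; last exact: mulrC.
apply: below_sum => -[i /= ik] _; have [sk|ks] := leqP s (k - i).
  by rewrite -(subnKC sk) exprD as0 !mul0r mul0rn.
suff h : below (a ^+ (k - i) * b ^+ i) M.
  move=> j /h hj; elim: 'C(k, i) => // n IH.
  by rewrite mulrS lcoefD hj IH addr0.
have := belowM (belowX (n := (k - i)%N) aD) (belowX (n := i) b1); apply: below_le.
have : ((k - i) * D <= s * D)%N by rewrite leq_mul2r (ltnW ks) orbT.
have -> : (- (D%:Z)) *+ (k - i) = - ((k - i) * D)%N%:Z.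
  by rewrite mulNrn -mulr_natr natz -PoszM mulnC.
have -> : (1 : int) *+ i = i%:Z by rewrite -mulr_natr mul1r natz.
lia.
Qed.

Lemma topnil_cube f : topnil f -> f = f ^+ 3 -> f = 0.
Proof.
move=> fn f3; have fX (k : nat) : f = f ^+ (2 * k).+1.
  elim: k => [|k IH]; first by rewrite expr1.
  have -> : (2 * k.+1).+1 = (2 + (2 * k).+1)%N by lia.
  by rewrite exprD -IH -exprSr.
apply: laurentP => i; have [K fK] := topnilX fn (i + 1).
by rewrite (fX K) fK ?lcoef0 //; lia.
Qed.

(** At every prime the lowest exponent of [f] is nonnegative, since a negative one would double on
    squaring. Hence [f 0] is idempotent modulo nilpotents and lifts to [c]. The difference of two
    commuting idempotents equals its cube; here it is also topologically nilpotent, so it equals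
    arbitrarily high powers of itself and vanishes. *)
Lemma idem_laurent f : idem f -> exists2 c, idem c & f = laurent_const c.
Proof.
move=> ff; have low p : spec_below p f 0.
  move=> i i0; apply: contrapT => pi.
  have [k [pk fk]] := spec_lowest (ex_intro (fun i => ~ p (f i)) i pi).
  have k0 : k < 0.
    by rewrite ltNge; apply/negP => k0; apply: pi; apply: fk; lia.
  have := spec_belowM fk fk; rewrite ff => /specN; rewrite opprB => /specBK h.
  by have /h/specM[] : p (f (k + k)) by apply: fk; lia.
have [c [y [z [cc cE c1E]]]] : exists c y z,
    [/\ idem c, c = f 0 * y & 1 - c = (1 - f 0) * z].
  apply: idem_lift; apply/nilpotentP => p.
  have := spec_belowM (low p) (low p); rewrite addr0 ff.
  by rewrite mulrBr mulr1.
exists c => //; pose e := laurent_const c.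
have ee : idem e by rewrite /idem /e -rmorphM cc.
suff : f - e = 0 by move/eqP; rewrite subr_eq0 => /eqP.
apply: topnil_cube => [i|].
  rewrite le_eqVlt => /orP[/eqP ->|i0]; apply/nilpotentP => p; rewrite lcoefB /=; last first.
    by rewrite lt_eqF // subr0; exact: low.
  have [/[dup] fp|fp] : p (f 0) \/ p (1 - f 0).
    apply: specM; have := spec_belowM (low p) (low p); rewrite addr0 ff.
    by rewrite mulrBr mulr1.
    by move=> _; apply: specB => //; rewrite cE; exact: specMr.
  have -> : f 0 - c = (1 - c) - (1 - f 0) by ring.
  by apply: specB => //; rewrite c1E; exact: specMr.
have -> : (f - e) ^+ 3 = f * f * f - (f * f) * e *+ 3 + f * (e * e) *+ 3 - e * e * e by ring.
by rewrite ff ee ff ee; ring.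
Qed.

End OneVariable.

(** * Multi-indices and the topology *)

Section MultiIndex.
Implicit Types n : nat.

Definition mext n (l : mindex n) (i : int) : mindex n.+1 :=
  [ffun j => if unlift ord_max j is Some k then l k else i].

Lemma mlast_ext n (l : mindex n) i : mlast (mext l i) = i.
Proof. by rewrite /mlast ffunE unlift_none. Qed.
Lemma mfront_ext n (l : mindex n) i : mfront (mext l i) = l.
Proof. by apply/ffunP => j; rewrite !ffunE liftK. Qed.
Lemma mext_eta n (l : mindex n.+1) : mext (mfront l) (mlast l) = l.
Proof.
by apply/ffunP => j; rewrite ffunE /mlast; case: unliftP => [k|] ->; rewrite ?ffunE.
Qed.
Lemma mindexS_eq n (l l' : mindex n.+1) :
  mlast l = mlast l' -> mfront l = mfront l' -> l = l'.
Proof. by move=> e1 e2; rewrite -[l]mext_eta -[l']mext_eta e1 e2. Qed.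
Lemma mindex0_eq (l l' : mindex 0) : l = l'.
Proof. by apply/ffunP => -[]. Qed.

Lemma mlastD n (l l' : mindex n.+1) : mlast (l + l') = mlast l + mlast l'.
Proof. by rewrite /mlast ffunE. Qed.
Lemma mlastN n (l : mindex n.+1) : mlast (- l) = - mlast l.
Proof. by rewrite /mlast ffunE. Qed.
Lemma mfrontD n (l l' : mindex n.+1) : mfront (l + l') = mfront l + mfront l'.
Proof. by apply/ffunP => j; rewrite !ffunE. Qed.
Lemma mfrontN n (l : mindex n.+1) : mfront (- l) = - mfront l.
Proof. by apply/ffunP => j; rewrite !ffunE. Qed.

Definition mdelta n (i : 'I_n) : mindex n := [ffun j => (j == i)%:R].

Lemma mlast_delta_max n : mlast (mdelta (@ord_max n)) = 1.
Proof. by rewrite /mlast ffunE eqxx. Qed.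
Lemma mlast_delta_lift n (i : 'I_n) : mlast (mdelta (lift ord_max i)) = 0.
Proof. by rewrite /mlast ffunE (negPf (neq_lift _ _)). Qed.
Lemma mfront_delta_max n : mfront (mdelta (@ord_max n)) = 0.
Proof. by apply/ffunP => j; rewrite !ffunE eq_sym (negPf (neq_lift _ _)). Qed.
Lemma mfront_delta_lift n (i : 'I_n) : mfront (mdelta (lift ord_max i)) = mdelta i.
Proof. by apply/ffunP => j; rewrite !ffunE (inj_eq lift_inj). Qed.

(** Positivity with an explicit witness: [j] is the pivot row when [l] is read as an echelon
    column. *)
Definition lexpos n (l : mindex n) : Prop :=
  exists j : 'I_n, 0 < l j /\ forall j' : 'I_n, (j < j')%N -> l j' = 0.

Lemma lexposS n (l : mindex n.+1) :
  lexpos l = (0 < mlast l \/ (mlast l = 0 /\ lexpos (mfront l))).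
Proof.
apply/propext; split=> [[j [lj l0]]|[l0|[l0 [j [lj lj0]]]]].
- case: (unliftP ord_max j) => [k|] ej; rewrite ej in lj l0; last by left.
  right; split; first by apply: l0; rewrite lift_max /= ltn_ord.
  exists k; rewrite ffunE; split=> // j' kj'; rewrite ffunE l0 //.
  by rewrite !lift_max.
- by exists ord_max; split=> // j' /=; have := ltn_ord j'; rewrite ltnS leqNgt => /negPf ->.
exists (lift ord_max j); rewrite ffunE in lj; split=> // j'.
case: (unliftP ord_max j') => [k|] -> //; rewrite !lift_max => /lj0.
by rewrite ffunE.
Qed.

Lemma lexpos_total n (l : mindex n) : [\/ l = 0, lexpos l | lexpos (- l)].
Proof.
elim: n l => [l|n IH l]; first by constructor 1; exact: mindex0_eq.
rewrite !lexposS mlastN mfrontN.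
have [h|h|h] := ltgtP (mlast l) 0.
- by constructor 3; left; lia.
- by constructor 2; left.
have [h'|h'|h'] := IH (mfront l).
- constructor 1; apply: mindexS_eq; first by rewrite h /mlast ffunE.
  by rewrite h'; apply/ffunP => j; rewrite !ffunE.
- by constructor 2; right.
- by constructor 3; right; rewrite h oppr0.
Qed.

Lemma lexltP n (l l' : mindex n) : lexlt l l' <-> lexpos (l' - l).
Proof.
suff le_pos m (k k' : mindex m) : lexle k k' <-> k = k' \/ lexpos (k' - k).
  rewrite /lexlt; split=> [/andP[/le_pos[-> /eqP//|//]]|h].
  apply/andP; split; first by apply/le_pos; right.
  by apply/eqP => ll; rewrite ll subrr in h; case: h => j []; rewrite ffunE ltxx.
elim: m k k' => [k k'|m IH k k'].
  by split=> // _; left; exact: mindex0_eq.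
rewrite lexposS mlastD mlastN mfrontD mfrontN /=; split.
  move=> /orP[h|/andP[/eqP h /IH[h'|h']]].
  - by right; left; lia.
  - by left; exact: mindexS_eq.
  - by right; right; split=> //; lia.
move=> [->|[h|[h h']]].
- by rewrite eqxx; apply/orP; right; apply/IH; left.
- by apply/orP; left; lia.
by apply/orP; right; apply/andP; split; [lia|apply/IH; right].
Qed.

Lemma Zlam_pt n (l : mindex n) : exists lam : Lambda n, Zlam lam l.
Proof.
elim: n l => [l|n IH l]; first by exists tt.
by have [lam h] := IH (mfront l); exists (fun=> lam, mlast l).
Qed.

Lemma finite_int_interval (a b : int) : finite_set [set i : int | a <= i < b].
Proof.
apply: (@sub_finite_set _ _ [set` window a (absz (b - a))]); last exact: finite_seq.
by move=> i /= hi; rewrite mem_window; lia.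
Qed.

Lemma Zlam_finite n (lam mu : Lambda n) :
  finite_set [set l | Zlam lam l /\ Zlam mu (- l)].
Proof.
elim: n lam mu => [lam mu|n IH lam mu].
  by apply: (@sub_finite_set _ _ [set 0]) => // l _ /=; exact: mindex0_eq.
apply: (@sub_finite_set _ _ (\bigcup_(i in [set i : int | lam.2 <= i < - mu.2 + 1])
   [set mext l i | l in [set l | Zlam (lam.1 i) l /\ Zlam (mu.1 (- i)) (- l)]])).
  move=> l /= [[h1 h2] [k1 k2]]; rewrite mlastN in k1 k2; rewrite mfrontN in k2.
  exists (mlast l) => /=; first by lia.
  by exists (mfront l) => //; exact: mext_eta.
apply: bigcup_finite; first exact: finite_int_interval.
by move=> i _; apply: finite_image; exact: IH.
Qed.

Lemma finite_set_lbound (T : eqType) (h : T -> int) (S : set T) : finite_set S ->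
  exists N, forall x, S x -> N <= h x.
Proof.
move=> /finite_seqP[s ->]; elim: s => [|y s [N sN]]; first by exists 0.
exists (Num.min N (h y)) => x /=; rewrite inE => /orP[/eqP ->|/sN]; lia.
Qed.

(* [Z_lam] and [- Z_mu] are dual to each other for the relation of having a
   finite intersection; this is the completeness of [L^n(A)]. *)
Lemma Zlam_dual n (S : set (mindex n)) :
  (forall lam : Lambda n, finite_set [set l | S l /\ Zlam lam (- l)]) ->
  exists mu : Lambda n, S `<=` Zlam mu.
Proof.
elim: n S => [S _|n IH S Sfin]; first by exists tt.
have /choice[mu hmu] : forall i, exists mu : Lambda n,
    [set l | S (mext l i)] `<=` Zlam mu.
  move=> i; apply: IH => lam.
  apply: (@sub_finite_set _ _ (@mfront n @`
    [set l | S l /\ @Zlam n.+1 (fun=> lam, - i) (- l)])); last first.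
    exact/finite_image/Sfin.
  move=> l /= [Sl lamS]; exists (mext l i); last exact: mfront_ext.
  by rewrite mlastN mlast_ext mfrontN mfront_ext.
have [N SN] : exists N, forall l, S l -> N <= mlast l.
  (* For each last coordinate [- j] occurring in [S] one point of [S] is selected. The single index
     [(nu, 0)] captures the negatives of all selected points with [j >= 0], so finiteness bounds the
     last coordinates below. *)
  have /choice[nu hnu] : forall j : int, exists lam : Lambda n,
      forall l, S l -> mlast l = - j ->
      exists l', [/\ S l', mlast l' = - j & Zlam lam (- mfront l')].
    move=> j; have [[l [Sl lj]]|h] := pselect (exists l, S l /\ mlast l = - j).
      by have [lam hl] := Zlam_pt (- mfront l); exists lam => l' _ _; exists l.
    by exists (lam0 n) => l Sl lj; case: h; exists l.
  have [N TN] := finite_set_lbound (@mlast n) (Sfin (nu, 0)).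
  exists (Num.min N 0) => l Sl; rewrite leNgt; apply/negP => lN.
  have [|l' [Sl' ll' nul']] := hnu (- mlast l) l Sl; first by rewrite opprK.
  rewrite opprK in ll'.
  suff : N <= mlast l' by lia.
  by apply: TN; split=> //; rewrite /= mlastN mfrontN ll'; split=> //; lia.
exists (mu, N) => l Sl; split; first exact: SN.
by apply: hmu => /=; rewrite mext_eta.
Qed.

End MultiIndex.

(** * Slices, monomials and density in iterated Laurent rings *)

Section Iterated.
Variable A : comPzRingType.
Implicit Types n m : nat.

Definition sl n (f : itLaurent A n.+1) (i : int) : itLaurent A n :=
  (f : laurent (itL A n)) i.

Lemma slD n (f g : itLaurent A n.+1) i : sl (f + g) i = sl f i + sl g i. Proof. by []. Qed.
Lemma itcoefS n (f : itLaurent A n.+1) l : itcoef f l = itcoef (sl f (mlast l)) (mfront l).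
Proof. by []. Qed.
Lemma itcoef_ext n (f : itLaurent A n.+1) l i : itcoef f (mext l i) = itcoef (sl f i) l.
Proof. by rewrite itcoefS mlast_ext mfront_ext. Qed.

Lemma itcoef_sum n (I : Type) (s : seq I) (P : pred I) (F : I -> itLaurent A n) l :
  itcoef (\sum_(x <- s | P x) F x) l = \sum_(x <- s | P x) itcoef (F x) l.
Proof.
by apply: (big_morph (fun f => itcoef f l)) => [x y|]; [exact: itcoefD|exact: itcoef0].
Qed.

Fixpoint itmono n : mindex n -> itLaurent A n :=
  match n return mindex n -> itLaurent A n with
  | 0 => fun=> 1
  | k.+1 => fun w => @mono (itL A k) (itmono (mfront w)) (mlast w)
  end.

Lemma itmono0 n : itmono (0 : mindex n) = 1.
Proof.
elim: n => // n IH /=; have -> : mfront (0 : mindex n.+1) = 0 by apply/ffunP => j; rewrite !ffunE.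
by rewrite IH /mlast ffunE; exact: (@mono1 (itL A n)).
Qed.

Lemma itmonoD n (w w' : mindex n) : itmono (w + w') = itmono w * itmono w'.
Proof.
elim: n w w' => [w w'|n IH w w'] /=; first by rewrite mulr1.
by rewrite mfrontD mlastD IH; apply/esym; exact: (@monoM (itL A n)).
Qed.

Lemma itmono_var n (i : 'I_n) : itmono (mdelta i) = itvar A i.
Proof.
elim: n i => [[]//|n IH i] /=; case: unliftP => [j|] ->.
  rewrite mfront_delta_lift mlast_delta_lift IH; exact: (@mono_const (itL A n)).
rewrite mfront_delta_max mlast_delta_max itmono0; exact: (@mono_var (itL A n)).
Qed.

Lemma itcoef_mono n (w l : mindex n) : itcoef (itmono w) l = (l == w)%:R.
Proof.
elim: n w l => [w l|n IH w l]; first by rewrite (mindex0_eq l w) eqxx.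
rewrite itcoefS /sl /=; case: eqP => [e|e].
  rewrite IH; congr (_ %:R); congr nat_of_bool; apply/eqP/eqP => [e'|-> //].
  exact: mindexS_eq.
by rewrite itcoef0; case: eqP => // lw; case: e; rewrite lw.
Qed.

Lemma UnbhsS n (lam : Lambda n.+1) (f : itLaurent A n.+1) :
  Unbhs lam f <-> forall i, lam.2 <= i -> Unbhs (lam.1 i) (sl f (- i)).
Proof.
split=> [/UnbhsP fU i li|fU].
  apply/UnbhsP => l hl; rewrite -itcoef_ext.
  have -> : mext (- l) (- i) = - mext l i.
    by apply: mindexS_eq; rewrite ?mlastN ?mfrontN ?mlast_ext ?mfront_ext.
  by apply: fU; rewrite /= mlast_ext mfront_ext.
apply/UnbhsP => l [l1 l2]; rewrite itcoefS mlastN mfrontN.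
by have /UnbhsP := fU _ l1; apply.
Qed.

Lemma Unbhs_sum n (lam : Lambda n) (I : eqType) (s : seq I) (F : I -> itLaurent A n) :
  (forall i, i \in s -> Unbhs lam (F i)) -> Unbhs lam (\sum_(i <- s) F i).
Proof.
move=> FU; rewrite big_seq; apply: big_ind => //; first exact: Unbhs0.
exact: UnbhsD.
Qed.

Lemma Unbhs_hausdorff n (f : itLaurent A n) : (forall lam, Unbhs lam f) -> f = 0.
Proof.
move=> fU; apply: itcoefP => l; rewrite itcoef0.
have [lam hl] := Zlam_pt (- l); have /UnbhsP := fU lam.
by move=> /(_ _ hl); rewrite opprK.
Qed.

Lemma supp_bounded n (f : itLaurent A n) : exists lam : Lambda n, supp f `<=` Zlam lam.
Proof. by apply/(supp_itLaurentP (itcoef f)); exists f. Qed.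

(** Continuity at zero in terms of the basic neighbourhoods; for additive maps this is
    continuity. *)
Definition tcont n m (phi : itLaurent A n -> itLaurent A m) :=
  forall mu : Lambda m, exists lam : Lambda n, forall f, Unbhs lam f -> Unbhs mu (phi f).

Lemma tcontB n m (phi psi : itLaurent A n -> itLaurent A m) :
  tcont phi -> tcont psi -> tcont (fun f => phi f - psi f).
Proof.
move=> cphi cpsi mu; have [l1 h1] := cphi mu; have [l2 h2] := cpsi mu.
exists (lam_join l1 l2) => f /Unbhs_join[/h1 f1 /h2 f2]; exact: UnbhsB.
Qed.

Lemma zmod_morphismD (U V : zmodType) (h : U -> V) :
  zmod_morphism h -> h 0 = 0 /\ {morph h : x y / x + y}.
Proof.
move=> ah; have h0 : h 0 = 0 by rewrite -(subrr 0) ah subrr.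
by split=> // x y; rewrite -{1}[y]opprK ah -[- y]sub0r ah h0 sub0r opprK.
Qed.

Lemma tcont_continuous n m (phi : itLaurent A n -> itLaurent A m) :
  zmod_morphism phi -> continuous phi <-> tcont phi.
Proof.
move=> /zmod_morphismD[phi0 phiD]; split=> [cphi mu|cphi f V [mu Vmu]].
  have /(cphi 0) [lam hlam] : nbhs (phi 0) (Unbhs mu).
    by exists mu => g gU; rewrite phi0 add0r.
  by exists lam => f /hlam /=; rewrite add0r.
have [lam hlam] := cphi mu; exists lam => g /hlam gU /=.
by rewrite phiD; exact: Vmu.
Qed.

(** The support of [f] lies in some [Zlam mu], which meets [- Zlam lam] in finitely many points;
    only these have to be removed. *)
Lemma itLaurent_truncate n (lam : Lambda n) (f : itLaurent A n) : exists s : seq (mindex n),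
  Unbhs lam (f - \sum_(l <- s) itcoef f l *: itmono l).
Proof.
have [mu fmu] := supp_bounded f.
have /finite_seqP[s sE] := Zlam_finite mu lam; exists (undup s).
apply/UnbhsP => l hl; rewrite itcoefB itcoef_sum; apply/eqP; rewrite subr_eq0; apply/eqP.
have [fl|fl] := pselect (itcoef f (- l) = 0).
  rewrite fl big1_seq // => l' _; rewrite itcoefZ itcoef_mono.
  by case: eqP => [<-|_]; rewrite ?fl ?mul0r ?mulr0.
have ls : - l \in undup s.
  rewrite mem_undup; have : [set` s] (- l) by rewrite -sE /= opprK; split=> //; exact: fmu.
  by [].
rewrite (bigD1_seq (- l)) ?undup_uniq //= itcoefZ itcoef_mono eqxx mulr1.
by rewrite big1 ?addr0 // => l' ll'; rewrite itcoefZ itcoef_mono eq_sym (negPf ll') mulr0.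
Qed.

Lemma tcont_ext n m (phi psi : itLaurent A n -> itLaurent A m) :
  zmod_morphism phi -> zmod_morphism psi -> tcont phi -> tcont psi ->
  (forall a l, phi (a *: itmono l) = psi (a *: itmono l)) -> phi =1 psi.
Proof.
move=> aphi apsi cphi cpsi e f; apply/eqP; rewrite -subr_eq0; apply/eqP.
apply: Unbhs_hausdorff => mu; have [lam hlam] := tcontB cphi cpsi mu.
have [s hs] := itLaurent_truncate lam f.
set g := \sum_(_ <- _) _ in hs; have := hlam _ hs; rewrite aphi apsi.
suff -> : phi g = psi g by rewrite opprB addrA subrK.
have [phi0 phiD] := zmod_morphismD aphi; have [psi0 psiD] := zmod_morphismD apsi.
rewrite /g (big_morph phi phiD phi0) (big_morph psi psiD psi0).
by apply: eq_bigr => l _; exact: e.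
Qed.

End Iterated.

(** * Summable families of monomials *)

Section Summation.
Variable A : comPzRingType.
Implicit Types n m : nat.

Lemma lam_join_seq n (I : eqType) (s : seq I) (lam : I -> Lambda n) :
  exists mu, forall i, i \in s -> @Unbhs A n mu `<=` Unbhs (lam i).
Proof.
elim: s => [|i s [mu hmu]]; first by exists (lam0 n).
exists (lam_join (lam i) mu) => j; rewrite inE => /orP[/eqP ->|js] f /Unbhs_join[] //.
by move=> _; exact: hmu.
Qed.

(** Degree [- k] of [f] enters degree [- i] of the product through the coefficient of [g] in degree
    [k - i]. Since [g] is bounded below and [i >= mu.2], only finitely many [i] occur for each [k],
    so one condition on [sl f (- k)] serves them all. *)
Lemma tcont_mul n (g : itLaurent A n) : tcont ( *%R g).
Proof.
elim: n g => [g mu|n IH g mu].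
  exists mu => f /UnbhsP f0; apply/UnbhsP => l /f0 /= fl.
  by rewrite /= in fl *; rewrite fl; exact: mulr0.
have [b gb] := belowP (g : laurent (itL A n)).
have /choice[nu hnu] : forall ij : int * int, exists lam : Lambda n,
    forall f, Unbhs lam f -> Unbhs (mu.1 ij.2) (sl g ij.1 * f).
  by move=> ij; exact: IH.
have /choice[lam hlam] : forall k : int, exists lam : Lambda n,
    forall i, i \in window mu.2 (absz (k - b - mu.2 + 1)) -> forall f : itLaurent A n,
    Unbhs lam f -> Unbhs (mu.1 i) (sl g (k - i) * f).
  move=> k; have [lam hl] := lam_join_seq (window mu.2 (absz (k - b - mu.2 + 1)))
    (fun i => nu (k - i, i)).
  by exists lam => i /hl h f /h /hnu.
exists (lam, mu.2 + b) => f /UnbhsS fU; apply/UnbhsS => i mui.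
have [c fc] := belowP (f : laurent (itL A n)).
have -> : sl (g * f) (- i) =
    \sum_(j <- window b (absz (- i - c - b + 1))) sl g j * sl f (- i - j).
  have [h|h] := leP b (- i - c + 1).
    apply: (@lcoefM_window (itL A n) g f b c b _ (- i) gb fc) => //; lia.
  rewrite big1_seq => [|j]; last first.
    rewrite mem_window => /andP[_ hj]; rewrite [sl f _](fc (- i - j)) ?mulr0 //; lia.
  by apply: (belowM gb fc); lia.
apply: Unbhs_sum => j; rewrite mem_window => /andP[bj _].
have -> : - i - j = - (i + j) by lia.
have -> : sl g j = sl g (i + j - i) by congr sl; lia.
by apply: hlam; [rewrite mem_window; lia|apply: fU => /=; lia].
Qed.

(* The monomials of [L^n(A)] tend to zero along every [Z_lam]; [adm F] says
   that their prospective images [F l] do. *)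
Definition adm n m (F : mindex n -> itLaurent A m) : Prop :=
  forall (lam : Lambda n) (mu : Lambda m), finite_set [set l | Zlam lam l /\ ~ Unbhs mu (F l)].

Lemma adm_add n m (F G : mindex n -> itLaurent A m) :
  adm F -> adm G -> adm (fun l => F l + G l).
Proof.
move=> aF aG lam mu; have : finite_set ([set l | Zlam lam l /\ ~ Unbhs mu (F l)] `|`
    [set l | Zlam lam l /\ ~ Unbhs mu (G l)]) by rewrite finite_setU.
apply: sub_finite_set => l [hl FGl]; apply: contrapT => /not_orP[/not_andP[//|/contrapT Fl]].
by move=> /not_andP[//|/contrapT Gl]; apply: FGl; exact: UnbhsD.
Qed.

Lemma adm_mul n m (g : itLaurent A m) (F : mindex n -> itLaurent A m) :
  adm F -> adm (fun l => g * F l).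
Proof.
move=> aF lam mu; have [nu hnu] := tcont_mul g mu.
by apply: sub_finite_set (aF lam nu) => l [hl gF]; split=> // /hnu.
Qed.

Lemma adm_zero n m : adm (fun _ : mindex n => 0 : itLaurent A m).
Proof.
move=> lam mu; apply: (@sub_finite_set _ _ set0) => // l [_ []]; exact: Unbhs0.
Qed.

Section Sum.
Variables (n m : nat) (F : mindex n -> itLaurent A m).
Hypothesis admF : adm F.

Let cf (f : itLaurent A n) (s : mindex m) : A :=
  \sum_(l \in [set: mindex n]) itcoef f l * itcoef (F l) s.

Let cfE f s (r : seq (mindex n)) : uniq r ->
  (forall l, l \notin r -> itcoef f l * itcoef (F l) s = 0) ->
  cf f s = \sum_(l <- r) itcoef f l * itcoef (F l) s.
Proof.
move=> ur hr; rewrite /cf (fsbigE r) //; last by move=> l _; exact: hr.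
by apply: eq_bigl => l; rewrite in_setT.
Qed.

Let cf_support f s : exists2 r : seq (mindex n), uniq r &
  forall l, l \notin r -> itcoef f l * itcoef (F l) s = 0.
Proof.
have [lam flam] := supp_bounded f; have [mu hmu] := Zlam_pt (- s).
have /finite_seqP[r rE] := admF lam mu; exists (undup r); first exact: undup_uniq.
move=> l; rewrite mem_undup => /negP lr.
have [->|fl] := pselect (itcoef f l = 0); first by rewrite mul0r.
have : ~ [set` r] l by [].
rewrite -rE => /not_andP[/(_ (flam _ fl))//|/contrapT /UnbhsP /(_ _ hmu)].
by rewrite opprK => ->; rewrite mulr0.
Qed.

(** The map sends [f] to the sum of the [itcoef f l *: F l], formed coefficientwise. On [- Zlam mu]
    only finitely many [l] contribute, each at finitely many points, so [Zlam_dual] bounds the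
    support of the result. *)
Lemma adm_sum : exists phi : itLaurent A n -> itLaurent A m,
  [/\ linear phi, tcont phi & forall l, phi (itmono A l) = F l].
Proof.
have /choice[phi phiE] : forall f, exists g : itLaurent A m, forall s, itcoef g s = cf f s.
  move=> f; apply/supp_itLaurentP; have [lam flam] := supp_bounded f.
  apply: Zlam_dual => mu.
  apply: (@sub_finite_set _ _ (\bigcup_(l in [set l | Zlam lam l /\ ~ Unbhs mu (F l)])
      [set s | supp (F l) s /\ Zlam mu (- s)])); last first.
    apply: bigcup_finite => // l _; have [nu hnu] := supp_bounded (F l).
    by apply: sub_finite_set (Zlam_finite nu mu) => s [/hnu].
  move=> s [/= cfs hs]; have [r ur rE] := cf_support f s.
  apply: contrapT => nl; apply: cfs; rewrite (cfE ur rE) big1 // => l _.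
  have [->|fl] := pselect (itcoef f l = 0); first by rewrite mul0r.
  have [->|Fl] := pselect (itcoef (F l) s = 0); first by rewrite mulr0.
  case: nl; exists l; last by split.
  split; first exact: flam.
  by move=> /UnbhsP /(_ _ hs); rewrite opprK.
exists phi; split.
- move=> a f g; apply: itcoefP => s; rewrite itcoefD itcoefZ !phiE.
  have [r1 _ rE1] := cf_support f s; have [r2 _ rE2] := cf_support g s.
  pose r := undup (r1 ++ r2); have ur : uniq r by exact: undup_uniq.
  have nr l : l \notin r -> (l \notin r1) * (l \notin r2).
    by rewrite mem_undup mem_cat negb_or => /andP[-> ->].
  rewrite (@cfE f s r) // => [|l /nr[/rE1 //]].
  rewrite (@cfE g s r) // => [|l /nr[_ /rE2 //]].
  rewrite (@cfE _ s r) // => [|l /nr[/rE1 fl /rE2 gl]]; last first.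
    by rewrite itcoefD itcoefZ mulrDl gl -mulrA fl mulr0 addr0.
  rewrite mulr_sumr -big_split /=; apply: eq_bigr => l _.
  by rewrite itcoefD itcoefZ mulrDl mulrA.
(* Duality in the source: the negatives of all [l] with [F l] outside [Unbhs mu] lie in one
   [Zlam lam], so the coefficients at these [l] of any [f] in [Unbhs lam] are zero. *)
- move=> mu; have [lam hlam] : exists lam : Lambda n,
      [set l | ~ Unbhs mu (F (- l))] `<=` Zlam lam.
    apply: Zlam_dual => lam; have := finite_image (fun l : mindex n => - l) (admF lam mu).
    by apply: sub_finite_set => l [Fl hl]; exists (- l); rewrite ?opprK.
  exists lam => f /UnbhsP fU; apply/UnbhsP => s hs.
  have [r ur rE] := cf_support f (- s); rewrite phiE (cfE ur rE) big1 // => l _.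
  have [hl|nhl] := pselect (Zlam lam (- l)).
    by have := fU _ hl; rewrite opprK => ->; rewrite mul0r.
  have /contrapT/UnbhsP -> // : ~ ~ Unbhs mu (F l) by move=> Fl; apply/nhl/hlam; rewrite /= opprK.
  by rewrite mulr0.
move=> l; apply: itcoefP => s; rewrite phiE (@cfE _ s [:: l]) //.
  by rewrite big_seq1 itcoef_mono eqxx mul1r.
by move=> l'; rewrite inE itcoef_mono => /negPf ->; rewrite mul0r.
Qed.

(** Both sides of multiplicativity are additive and continuous in each variable separately, so
    density of the monomials is applied to one variable at a time. *)
Lemma adm_morph : F 0 = 1 -> (forall l l', F (l + l') = F l * F l') ->
  exists phi : itLaurent A n -> itLaurent A m,
  [/\ linear phi, monoid_morphism phi, tcont phi & forall l, phi (itmono A l) = F l].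
Proof.
move=> F0 FD; have [phi [lphi cphi phiE]] := adm_sum; exists phi; split=> //.
have aphi : zmod_morphism phi.
  by move=> x y; rewrite -scaleN1r addrC lphi addrC scaleN1r.
have zphi a x : phi (a *: x) = a *: phi x.
  have phi0 : phi 0 = 0 by rewrite -(subrr 0) aphi subrr.
  by rewrite -[a *: x]addr0 lphi phi0 addr0.
have cm g : tcont (fun x => phi g * phi x).
  move=> mu; have [nu hnu] := tcont_mul (phi g) mu; have [lam hl] := cphi nu.
  by exists lam => f /hl /hnu.
have cm' g : tcont (fun x => phi (g * x)).
  move=> mu; have [nu hnu] := cphi mu; have [lam hl] := tcont_mul g nu.
  by exists lam => f /hl /hnu.
have am g : zmod_morphism (fun x => phi g * phi x) by move=> x y; rewrite aphi mulrBr.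
have am' g : zmod_morphism (fun x => phi (g * x)) by move=> x y; rewrite mulrBr aphi.
have scM k a b (x y : itLaurent A k) : (a *: x) * (b *: y) = (a * b) *: (x * y).
  by rewrite !itscaleE mulrACA rmorphM.
have phiM1 a l : (fun x => phi ((a *: itmono A l) * x)) =1 (fun x => phi (a *: itmono A l) * phi x).
  apply: tcont_ext => // b l'.
  by rewrite scM !zphi scM -itmonoD !phiE FD.
split; first by rewrite -itmono0 phiE.
move=> x; apply: tcont_ext => // a l.
by rewrite mulrC phiM1 mulrC.
Qed.

End Sum.
End Summation.

(** * Leading exponents of invertible series *)

Section UnitLocal.
Variable R : comPzRingType.

(** With [k] the lowest exponent of [f] at [P], the element [x := f k * f' (- k)] is congruent to 1
    at primes where [k] is still the lowest exponent and to 0 at all others; [e] lifts this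
    idempotent. Adding [1 - e] to [e * f k] gives a unit of [R] itself, without a change of ring. *)
Lemma unit_local (f f' : laurent R) (P : Spec R) : f * f' = 1 -> exists k e,
  [/\ idem e, ~ P e, invertible (e * f k + (1 - e)) &
      forall j, j < k -> nilpotent (e * f j)].
Proof.
move=> ff'; have [k [fk f'k xk _]] := unit_lowest P ff'.
pose x := f k * f' (- k).
have low (Q : Spec R) : Q (1 - x) /\ spec_below Q f k \/ Q x.
  have [k' [fk' f'k' xk' _]] := unit_lowest Q ff'.
  have [kk'|k'k|kk'] := ltgtP k k'.
  - by right; apply: specMr; exact: fk'.
  - by right; apply: specMl; apply: f'k'; lia.
  - by left; rewrite /x -opprB kk'; split=> //; exact: specN.
have [e [y [z [ee eE e1E]]]] : exists e y z,
    [/\ idem e, e = x * y & 1 - e = (1 - x) * z].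
  apply: idem_lift; apply/nilpotentP => Q.
  by have [[Qx _]|Qx] := low Q; [exact: specMl|exact: specMr].
exists k, e; split=> //.
- move=> Pe; apply: (@spec1 _ P); rewrite -(subrK e 1); apply: specD => //.
  by rewrite e1E; apply: specMr; rewrite -opprB; exact: specN.
- exists (e * f' (- k) * y + (1 - e)).
  have -> : (e * f k + (1 - e)) * (e * f' (- k) * y + (1 - e)) =
    e * e * (x * y) + (1 - e) * (1 - e) + (e - e * e) * (f k + f' (- k) * y).
    by rewrite /x; ring.
  by rewrite -eE ee ee subrr mul0r addr0 (idemC ee) addrC subrK.
move=> j jk; apply/nilpotentP => Q; have [[_ h]|Qx] := low Q.
  by apply: specMl; exact: h.
by rewrite eE -mulrA; apply: specMr.
Qed.

(** Primality is Gauss's argument: the product of the lowest coefficients outside [p] is, modulo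
    [p], a coefficient of the product. *)
Lemma spec_laurent_subproof (p : Spec R) : prime_ideal (fun f : laurent R => forall i, p (f i)).
Proof.
split.
- by move=> i; exact: spec0.
- by move=> f g pf pg i; exact: specD.
- move=> f g pg i; have := @lcoefM_spec _ p f g i 0 (fun j _ => specMl _ (pg (i - j))).
  by move/specBK; apply; exact: specMl.
- by move=> /(_ 0); exact: spec1.
move=> f g pfg; apply: contrapT => /not_orP[/existsNP/spec_lowest[k [pk fk]]].
move=> /existsNP/spec_lowest[k' [pk' gk']].
by have := spec_belowM fk gk' => /specBr/(_ (pfg _))/specM[].
Qed.

Definition spec_laurent p := MkSpec (spec_laurent_subproof p).

End UnitLocal.

Section LeadingExponent.
Variable A : comPzRingType.
Implicit Types (n m : nat) (p : Spec A).

(** The extension of [p] to the series with all coefficients in [p]. It allows statements about one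
    variable over [itL A m] to be used at a prime of [A]. *)
Fixpoint spec_it p m : Spec (itL A m) :=
  if m is k.+1 then spec_laurent (spec_it p k) else p.

Lemma spec_itP p m (f : itLaurent A m) : spec_it p m f <-> forall l, p (itcoef f l).
Proof.
elim: m f => [f|m IH f]; first by split=> [pf l|/(_ 0) pf]; exact: pf.
split=> [pf l|pf i]; first by have /IH := pf (mlast l); apply.
by apply: (proj2 (IH (sl f i))) => l; rewrite -itcoef_ext; exact: pf.
Qed.

Lemma sl_constM m a (f : itLaurent A m.+1) i :
  sl (itconst m.+1 a * f) i = itconst m a * sl f i.
Proof. exact: (@lcoef_constM (itL A m)). Qed.

Lemma itcoef_constM m a (f : itLaurent A m) l : itcoef (itconst m a * f) l = a * itcoef f l.
Proof. exact: itcoefZ. Qed.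

Lemma idem_itLaurent m (f : itLaurent A m) : idem f -> exists2 c, idem c & f = itconst m c.
Proof.
elim: m f => [f ff|m IH f /(@idem_laurent (itL A m))[g /IH[c cc ->] ->]]; first by exists f.
by exists c.
Qed.

Lemma spec_it_const p m a : spec_it p m (itconst m a) <-> p a.
Proof.
split=> [/spec_itP /(_ 0)|pa].
  by rewrite -[itconst m a]mulr1 itcoef_constM -itmono0 itcoef_mono eqxx mulr1.
by apply/spec_itP => l; rewrite -[itconst m a]mulr1 itcoef_constM; exact: specMr.
Qed.

(* The coefficients below the leading exponent are required to be nilpotent as
   elements of the smaller Laurent ring, not just coefficientwise. *)
Fixpoint good m : mindex m -> itLaurent A m -> Prop :=
  match m return mindex m -> itLaurent A m -> Prop with
  | 0 => fun _ g => invertible g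
  | k.+1 => fun l g => [/\ invertible g, forall j, j < mlast l -> nilpotent (sl g j) &
                           good (mfront l) (sl g (mlast l))]
  end.

Lemma good_invertible m l (g : itLaurent A m) : good l g -> invertible g.
Proof. by case: m l g => [//|m] l g []. Qed.

(** [unit_local] at [spec_it p m] yields an idempotent, which comes from [A], and a leading
    coefficient that becomes a unit of the smaller ring; the induction hypothesis applies to that
    unit. *)
Lemma invertible_good p m (f : itLaurent A m) : invertible f -> exists e l g,
  [/\ idem e, ~ p e, good l g & itconst m e * f = itconst m e * g].
Proof.
elim: m f => [f fi|m IH f [f' ff']].
  by exists 1, 0, f; split=> //; [rewrite /idem mulr1|exact: spec1].
have [k [e0 [ee Pe inv nil]]] := @unit_local (itL A m) f f' (spec_it p m) ff'.
have [e eI e0E] := idem_itLaurent ee; rewrite {}e0E {e0} in ee Pe inv nil.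
have pe : ~ p e by move/(spec_it_const p m e).
have [e' [l [g [eI' pe' gg ef]]]] := IH _ inv.
pose E := e * e'; have EI : idem E by exact: idemM.
have [g' gg'] := good_invertible gg.
pose t c j : itLaurent A m.+1 := @mono (itL A m) c j.
(* [G] is [f] on the part cut out by [E] and [g] times a power of the last variable on the
   complement, which makes it good over all of [A]. *)
pose G : itLaurent A m.+1 := itconst m.+1 E * f + itconst m.+1 (1 - E) * t g k.
have cE a b : itconst m.+1 a * itconst m.+1 b = itconst m.+1 (a * b) by rewrite rmorphM.
have E0 : E * (1 - E) = 0 by rewrite mulrBr mulr1 EI subrr.
have EIC := idemC EI.
have tt' : t g k * t g' (- k) = 1.
  by rewrite /t; have := @monoM (itL A m) g g' k (- k); rewrite subrr gg' mono1.
have slt j : sl (t g k) j = if j == k then g else 0 by [].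
have EG : itconst m e * itconst m e' * sl (f : itLaurent A m.+1) k = itconst m e * itconst m e' * g.
  have := congr1 (fun x => itconst m e * x) ef.
  rewrite !mulrA => <-; have eeI : itconst m e * itconst m e = itconst m e by [].
  rewrite /sl mulrDr !mulrA [X in _ = X * _ + _]mulrAC eeI -mulrA.
  have -> : itconst m e * itconst m e' * (1 - itconst m e) =
    (itconst m e - itconst m e * itconst m e) * itconst m e' by ring.
  by rewrite eeI subrr mul0r addr0 mulrA.
exists E, (mext l k), G; split=> //.
- by case/specM.
- split.
  + exists (itconst m.+1 E * f' + itconst m.+1 (1 - E) * t g' (- k)).
    have -> : G * (itconst m.+1 E * f' + itconst m.+1 (1 - E) * t g' (- k)) =
      itconst m.+1 E * itconst m.+1 E * (f * f')
      + itconst m.+1 (1 - E) * itconst m.+1 (1 - E) * (t g k * t g' (- k))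
      + itconst m.+1 E * itconst m.+1 (1 - E) * (f * t g' (- k) + f' * t g k) by rewrite /G; ring.
    rewrite !cE EI EIC E0 ff' tt' !mulr1 rmorph0 mul0r addr0 -rmorphD.
    by rewrite addrC subrK rmorph1.
  + move=> j; rewrite mlast_ext => jk; rewrite slD !sl_constM slt lt_eqF // mulr0 addr0.
    have [n nn] := nil j jk; exists n; rewrite /E rmorphM -mulrA mulrCA exprMn.
    by rewrite [X in _ * X]nn mulr0.
  + rewrite mlast_ext mfront_ext slD !sl_constM slt eqxx.
    suff -> : itconst m E * sl f k + itconst m (1 - E) * g = g by [].
    by rewrite rmorphM EG -rmorphM -mulrDl -rmorphD addrC subrK rmorph1 mul1r.
- by rewrite /G mulrDr !mulrA !cE EI E0 rmorph0 mul0r addr0.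
Qed.

(** The value of [nu] at the single prime [p], expressed without a decomposition of [A]. *)
Definition lead p m (f : itLaurent A m) (l : mindex m) : Prop :=
  ~ p (itcoef f l) /\ forall l', lexpos (l - l') -> p (itcoef f l').

Lemma leadS p m (f : itLaurent A m.+1) l : lead p f l <->
  spec_below (spec_it p m) f (mlast l) /\ lead p (sl f (mlast l)) (mfront l).
Proof.
split=> [[pl fl]|[fl [pl fl']]]; split.
- move=> i il; apply/(@spec_itP p m) => l'; rewrite -[X in p X](itcoef_ext f).
  by apply: fl; rewrite lexposS mlastD mlastN mlast_ext; left; lia.
- split=> // l' hl; rewrite -itcoef_ext; apply: fl.
  by rewrite lexposS mlastD mlastN mfrontD mfrontN mlast_ext mfront_ext subrr; right.
- by [].
move=> l'; rewrite lexposS mlastD mlastN mfrontD mfrontN => -[h|[h h']].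
  rewrite itcoefS; have /(@spec_itP p m) : spec_it p m (sl f (mlast l')) by apply: fl; lia.
  exact.
have e : mlast l' = mlast l by lia.
by rewrite itcoefS e; exact: fl'.
Qed.

Lemma lead_uniq p m (f : itLaurent A m) l l' : lead p f l -> lead p f l' -> l = l'.
Proof.
move=> [pl hl] [pl' hl']; have [/eqP|h|h] := lexpos_total (l - l').
- by rewrite subr_eq0 => /eqP.
- by case: pl'; exact: hl.
- by case: pl; apply: hl'; rewrite -opprB.
Qed.

Lemma lead_congr p m (f g : itLaurent A m) l :
  (forall l', p (itcoef f l' - itcoef g l')) -> lead p f l -> lead p g l.
Proof.
move=> fg [pl hl]; split=> [gl|l' /hl]; last exact: specBr.
by apply: pl; exact: specBK (fg l) gl.
Qed.

Lemma leadM p m (f g : itLaurent A m) l l' :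
  lead p f l -> lead p g l' -> lead p (f * g) (l + l').
Proof.
elim: m f g l l' => [f g l l' [pf _] [pg _]|m IH f g l l' /leadS[fl lf] /leadS[gl lg]].
  by split=> [/specM[]//|l'' [[]]].
apply/leadS; rewrite mlastD mfrontD; split; first exact: (@spec_belowM_lt (itL A m)).
apply: lead_congr (IH _ _ _ _ lf lg) => l''; rewrite -itcoefB.
have /(@spec_itP p m) := spec_belowM fl gl => /(_ l'').
by move/specN; rewrite -itcoefN opprB.
Qed.

Lemma good_lead p m l (g : itLaurent A m) : good l g -> lead p g l.
Proof.
elim: m l g => [l g [g' gg']|m IH l g [_ nil /IH lg]].
  split=> [pg|l' [[]]//]; apply: (@spec1 _ p).
  by have <- : g * g' = 1 by []; exact: specMr.
apply/leadS; split=> // i il; have /(@nilpotentP (itL A m)) h := nil i il; exact: h.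
Qed.

Lemma lead_local p m (f g : itLaurent A m) e l :
  ~ p e -> itconst m e * f = itconst m e * g -> lead p g l -> lead p f l.
Proof.
move=> pe ef; apply: lead_congr => l'.
have : p (e * (itcoef g l' - itcoef f l')).
  by rewrite mulrBr -!itcoef_constM ef subrr; exact: spec0.
by case/specM.
Qed.

Lemma invertible_lead p m (f : itLaurent A m) : invertible f -> exists e l,
  [/\ idem e, ~ p e & forall q : Spec A, ~ q e -> lead q f l].
Proof.
move=> /(invertible_good p)[e [l [g [eI pe gg ef]]]]; exists e, l; split=> // q qe.
exact: lead_local qe ef (good_lead q gg).
Qed.

End LeadingExponent.

(** * Partitions of unity by idempotents, and the corresponding factor rings *)

Section Partition.
Variable A : comPzRingType.

(** Quasi-compactness of the spectrum in idempotent form. The scalars fixed by multiplication with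
    the sum of some orthogonal list of good idempotents form an ideal, and this ideal is contained
    in no prime. *)
Lemma idem_partition (Q : A -> Prop) :
  (forall p : Spec A, exists e, [/\ idem e, ~ p e & Q e]) ->
  (forall e e', idem e' -> Q e -> Q (e * e')) ->
  exists s : seq A, [/\ forall e, e \in s -> idem e /\ Q e,
    pairwise (fun x y => x * y == 0) s & \sum_(e <- s) e = 1].
Proof.
move=> Qloc QM.
pose ok (s : seq A) := [/\ forall e, e \in s -> [/\ idem e, Q e & e * (\sum_(x <- s) x) = e],
  pairwise (fun x y => x * y == 0) s & idem (\sum_(e <- s) e)].
suff : exists s, ok s /\ 1 * (\sum_(e <- s) e) = 1.
  move=> [s [[s1 s2 _]]]; rewrite mul1r => sS; exists s; split=> // e /s1[]//.
apply: (@ideal_one A (fun a => exists s, ok s /\ a * (\sum_(e <- s) e) = a)).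
  split.
  - by exists [::]; rewrite big_nil mulr0; split=> //; split=> //; rewrite big_nil /idem mulr0.
  - move=> a b [s [[s1 s2 s3] sa]] [s' [[s1' s2' s3'] sb]].
    pose S := \sum_(e <- s) e; pose S' := \sum_(e <- s') e.
    (* Cutting the second list by [1 - S] makes it orthogonal to the first; the joint sum fixes
       whatever [S] or [S'] fixes. *)
    have SE : \sum_(e <- s ++ [seq x * (1 - S) | x <- s']) e = S + S' * (1 - S).
      by rewrite big_cat big_map -mulr_suml.
    have SC := idemC s3.
    have S0 : S * (1 - S) = 0 by rewrite mulrBr mulr1 s3 subrr.
    exists (s ++ [seq x * (1 - S) | x <- s']); rewrite SE; split; last first.
      have -> : (a + b) * (S + S' * (1 - S)) =
        a * S + (a - a * S) * S' + b * S' * (1 - S) + b * S by ring.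
      by rewrite sa sb subrr mul0r addr0; ring.
    split.
    + move=> e; rewrite SE mem_cat => /orP[/s1[eI Qe eS]|/mapP[x /s1'[xI Qx xS] ->]].
        split=> //; have -> : e * (S + S' * (1 - S)) = e * S + (e - e * S) * S' by ring.
        by rewrite eS subrr mul0r addr0.
      split; [exact: idemM|exact: QM|].
      have -> : x * (1 - S) * (S + S' * (1 - S)) =
        x * (S * (1 - S)) + x * S' * ((1 - S) * (1 - S)) by ring.
      by rewrite S0 mulr0 add0r xS SC.
    + rewrite pairwise_cat s2 /= pairwise_map; apply/andP; split.
        apply/allrelP => x _ /s1[_ _ xS] /mapP[y _ ->].
        by rewrite mulrCA mulrBr mulr1 xS subrr mulr0.
      apply: sub_pairwise s2' => x y /= /eqP xy.
      by rewrite mulrACA xy mul0r.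
    + rewrite SE.
      have -> : S + S' * (1 - S) = 1 - (1 - S) * (1 - S') by ring.
      by apply: idemC; apply: idemM; exact: idemC.
  - move=> r a [s [sok sa]]; exists s; split=> //.
    by rewrite -mulrA sa.
move=> p; have [e [eI pe Qe]] := Qloc p; exists e => //.
exists [:: e]; rewrite big_seq1; split=> //; split=> //; rewrite big_seq1 //.
by move=> x; rewrite inE => /eqP ->.
Qed.

Section Corner.
Variables (e : A) (eI : idem e).

(** The factor ring [e A] with unit [e]. The proof of idempotency is a parameter of the type because
    the ring structure depends on it. *)
Definition corner_of of idem e := {x : A | e * x == x}.
Local Notation corner := (corner_of eI).
HB.instance Definition _ := Choice.copy corner {x : A | e * x == x}.

Definition corner_val (x : corner) : A := \val x.
Local Notation cval := corner_val.
Let cvalP (x : corner) : e * cval x = cval x. Proof. by apply/eqP; case: x. Qed.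

Let mk_subproof a : e * (e * a) == e * a. Proof. by rewrite mulrA eI. Qed.
Definition to_corner (a : A) : corner := exist _ (e * a) (mk_subproof a).

Let cvalK a : cval (to_corner a) = e * a. Proof. by []. Qed.
Let cinj (x y : corner) : cval x = cval y -> x = y. Proof. exact: val_inj. Qed.

Let czero := to_corner 0.
Let cone := to_corner 1.
Let copp (x : corner) := to_corner (- cval x).
Let cadd (x y : corner) := to_corner (cval x + cval y).
Let cmul (x y : corner) := to_corner (cval x * cval y).

Let caddA : associative cadd.
Proof. by move=> x y z; apply: cinj; rewrite !cvalK !mulrDr !cvalP addrA. Qed.
Let caddC : commutative cadd.
Proof. by move=> x y; apply: cinj; rewrite !cvalK addrC. Qed.
Let cadd0 : left_id czero cadd.
Proof. by move=> x; apply: cinj; rewrite !cvalK mulr0 add0r cvalP. Qed.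
Let caddN : left_inverse czero copp cadd.
Proof. by move=> x; apply: cinj; rewrite !cvalK mulrN cvalP addNr mulr0. Qed.

HB.instance Definition _ := GRing.isZmodule.Build corner caddA caddC cadd0 caddN.

Let cmulA : associative cmul.
Proof. by move=> x y z; apply: cinj; rewrite !cvalK; ring. Qed.
Let cmulC : commutative cmul.
Proof. by move=> x y; apply: cinj; rewrite !cvalK [cval x * _]mulrC. Qed.
Let cmul1 : left_id cone cmul.
Proof. by move=> x; apply: cinj; rewrite !cvalK mulr1 mulrA eI cvalP. Qed.
Let cmulDl : left_distributive cmul cadd.
Proof. by move=> x y z; apply: cinj; rewrite !cvalK !mulrDr !cvalP !mulrDl mulrDr !mulrA eI. Qed.

HB.instance Definition _ := GRing.Zmodule_isComPzRing.Build corner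
  cmulA cmulC cmul1 cmulDl.

Let to_corner_zmod : zmod_morphism to_corner.
Proof.
move=> x y; apply: cinj; have -> (u v : corner) : cval (u - v) = e * (cval u + e * - cval v) by [].
by rewrite !cvalK -mulrN !mulrDr !mulrA !eI.
Qed.
Let to_corner_monoid : monoid_morphism to_corner.
Proof.
split=> // x y; apply: cinj; rewrite !cvalK.
by transitivity (e * e * e * (x * y)); [rewrite !eI|ring].
Qed.

HB.instance Definition _ :=
  GRing.isZmodMorphism.Build A corner to_corner to_corner_zmod.
HB.instance Definition _ :=
  GRing.isMonoidMorphism.Build A corner to_corner to_corner_monoid.

Lemma to_corner_eq a b : to_corner a = to_corner b :> corner <-> e * a = e * b.
Proof. by split=> [[]//|ab]; exact: cinj. Qed.

Lemma to_corner_val (x : corner) : to_corner (cval x) = x.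
Proof. by apply: cinj; rewrite cvalK cvalP. Qed.

Lemma corner_valP (x : corner) : e * cval x = cval x.
Proof. exact: cvalP. Qed.

End Corner.

End Partition.

Arguments to_corner [A e] eI a.
Arguments corner_of [A e] _.

(** * The map nu *)

Section Nu.
Variable A : comPzRingType.
Implicit Types (p q : Spec A).

Lemma Spec_eq p q : (forall a, p a <-> q a) -> p = q.
Proof.
case: p q => [P hP] [Q hQ] /= PQ; have e : P = Q by apply: funext => a; apply/propext.
by case: _ / e hQ {PQ} => hQ; congr MkSpec; exact: Prop_irrelevance.
Qed.

(** The idempotents of the product sum to 1, so one of them, [e i], is outside [p]; then [p] is the
    preimage of its own image in [B i]. *)
Lemma Spec_product k (B : 'I_k -> comPzRingType) (pi : forall i, {rmorphism A -> B i}) p :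
  bijective (fun (a : A) (i : 'I_k) => pi i a) ->
  exists i (q : Spec (B i)), p = Spec_map (pi i) q.
Proof.
move=> [g gK Kg]; have piinj a b : (forall i, pi i a = pi i b) -> a = b.
  by move=> ab; rewrite -[a]gK -[b]gK; congr g; apply: functional_extensionality_dep.
have gE b i : pi i (g b) = b i by exact: (congr1 (fun h => h i) (Kg b)).
pose e (i : 'I_k) := g (fun i' => (i' == i)%:R).
have eE i i' : pi i' (e i) = (i' == i)%:R by rewrite gE.
have [i pei] : exists i, ~ p (e i).
  apply: contrapT => nep; apply: (@spec1 _ p).
  have -> : 1 = \sum_i e i.
    apply: piinj => i; rewrite rmorph1 rmorph_sum (bigD1 i) //= eE eqxx.
    by rewrite big1 ?addr0 // => j /negPf; rewrite eE eq_sym => ->.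
  by apply: spec_sum => i _; apply: contrapT => h; apply: nep; exists i.
have surj b : exists a, pi i a = b.
  by exists (g (dfwith (fun j => 0 : B j) b)); rewrite gE dfwith_in.
(* Elements with the same component in [B i] become equal after multiplication by [e i], which is
   outside [p]. *)
have pik a b : pi i a = pi i b -> p a -> p b.
  move=> ab pa; suff : p (b * e i) by case/specM.
  suff <- : a * e i = b * e i by exact: specMr.
  apply: piinj => j; rewrite !rmorphM eE; case: eqP => [->|_]; last by rewrite !mulr0.
  by rewrite ab.
have qP : prime_ideal (fun b : B i => exists2 a, p a & pi i a = b).
  split.
  - by exists 0; [exact: spec0|exact: rmorph0].
  - by move=> _ _ [a pa <-] [b pb <-]; exists (a + b); [exact: specD|exact: rmorphD].
  - move=> x _ [b pb <-]; have [a <-] := surj x.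
    by exists (a * b); [exact: specMl|exact: rmorphM].
  - move=> [a pa]; rewrite -(rmorph1 (pi i)) => /pik /(_ pa); exact: spec1.
  move=> x y; have [a <-] := surj x; have [b <-] := surj y.
  move=> [c pc]; rewrite -rmorphM => /pik /(_ pc) /specM[pa|pb].
    by left; exists a.
  by right; exists b.
exists i, (MkSpec qP); apply: Spec_eq => a /=; split=> [pa|[b pb /pik]]; last exact.
by exists a.
Qed.

Lemma is_nu_lead n (f : itLaurent A n) v p : is_nu f v -> lead p f [ffun j => v j 0 p].
Proof.
move=> [k [B [pi [l [bij nil inv vl]]]]].
have [i [q ->]] := Spec_product p bij.
have -> : [ffun j => v j 0 (Spec_map (pi i) q)] = l i by apply/ffunP => j; rewrite ffunE vl.
split=> [/= qf|l' ll' /=].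
  have [y fy] := inv i; apply: (@spec1 _ q); rewrite -fy; exact: specMr.
have : lexlt l' (l i) by apply/lexltP.
by move=> /nil/nilpotentP /(_ q).
Qed.

(** Leading exponents are constant near each prime, so [idem_partition] gives finitely many
    orthogonal idempotents with one exponent each; the corner rings are the factors [B i]. *)
Lemma is_nu_exists n (f : itLaurent A n) : invertible f -> exists v, is_nu f v.
Proof.
move=> finv.
have [||s [sQ sorth s1]] := @idem_partition A (fun e => exists l,
    forall q, ~ q e -> lead q f l).
- move=> p; have [e [l [eI pe fl]]] := invertible_lead p finv.
  by exists e; split=> //; exists l.
- move=> e e' _ [l fl]; exists l => q qee'; apply: fl => qe; apply: qee'; exact: specMr.
pose k := size s; pose e (i : 'I_k) := tnth (in_tuple s) i.
have eI i : idem (e i) by have [] := sQ _ (mem_tnth i (in_tuple s)).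
have /choice[l el] : forall i : 'I_k, exists l, forall q, ~ q (e i) -> lead q f l.
  by move=> i; have [] := sQ _ (mem_tnth i (in_tuple s)).
have orth (i j : 'I_k) : i != j -> e i * e j = 0.
  move=> ij; wlog {ij} ij : i j / (i < j)%N.
    by move=> W; case: (ltngtP i j) => [/W //|/W|/val_inj/eqP]; [rewrite mulrC|rewrite (negPf ij)].
  apply/eqP; rewrite /e !(tnth_nth 0) /=.
  have /pairwiseP := sorth; move=> /(_ 0 i j); apply=> //; rewrite inE; exact: ltn_ord.
have e1 : \sum_i e i = 1 by rewrite -[RHS]s1 [RHS](big_tnth _ _ s).
have /choice[idx idxP] : forall q, exists i, ~ q (e i).
  move=> q; apply: contrapT => nq; apply: (@spec1 _ q); rewrite -e1.
  by apply: spec_sum => i _; apply: contrapT => h; apply: nq; exists i.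
have idxE q i : ~ q (e i) -> idx q = i.
  move=> qi; apply/eqP/negP => /negP /orth h.
  have : q (e (idx q) * e i) by rewrite h; exact: spec0.
  by case/specM => //; exact: idxP.
have vP (j : 'I_n) : locally_constant (fun q => l (idx q) j).
  by move=> q; exists (e (idx q)); [exact: idxP|move=> q' /idxE ->].
exists (\col_j MkZloc (vP j)).
exists k, (fun i => corner_of (eI i)), (fun i => to_corner (eI i)), l; split.
- exists (fun b : forall i, corner_of (eI i) => \sum_i corner_val (b i)) => [a|b].
    by rewrite -[RHS]mul1r -e1 mulr_suml.
  apply: functional_extensionality_dep => i; rewrite -[RHS]to_corner_val; apply/to_corner_eq.
  rewrite mulr_sumr (bigD1 i) //= big1 ?addr0 // => j ji.
  by rewrite -corner_valP mulrA orth 1?eq_sym // mul0r.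
- move=> i l' /lexltP ll'.
  have /nilpotentP[[|r] nr] : forall q, q (e i * itcoef f l').
    move=> q; have [qe|qe] := pselect (q (e i)); first exact: specMr.
    by apply: specMl; have [_] := el i q qe; apply.
  (* A nilpotency exponent 0 means [1 = 0] in [A]. It is treated apart because only positive powers
     of [e i] equal [e i]. *)
  + exists 0%N; rewrite expr0 -(rmorph1 (to_corner (eI i))) -(rmorph0 (to_corner (eI i))).
    by apply/to_corner_eq; move: nr; rewrite expr0 => ->.
  + exists r.+1; rewrite -rmorphXn -(rmorph0 (to_corner (eI i))).
    apply/to_corner_eq; rewrite mulr0 -{1}(idemX r (eI i)) -exprMn; exact: nr.
- move=> i; have [y [z yz]] : exists y z, 1 = e i * itcoef f (l i) * y + (1 - e i) * z.
    apply: (@ideal_one A (fun a => exists y z, a = e i * itcoef f (l i) * y + (1 - e i) * z)).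
      split; first by exists 0, 0; rewrite !mulr0 addr0.
      - by move=> a b [y [z ->]] [y' [z' ->]]; exists (y + y'), (z + z'); ring.
      - by move=> r a [y [z ->]]; exists (r * y), (r * z); ring.
    move=> q; have [qe|qe] := pselect (q (e i)).
      exists (1 - e i); first by exists 0, 1; rewrite mulr0 add0r mulr1.
      by move=> /specD /(_ qe); rewrite subrK; exact: spec1.
    exists (e i * itcoef f (l i)); first by exists 1, 0; rewrite mulr0 addr0 mulr1.
    by have [h _] := el i q qe; case/specM.
  exists (to_corner (eI i) y); rewrite -rmorphM -(rmorph1 (to_corner (eI i))).
  apply/to_corner_eq; rewrite [in RHS]yz mulrDr !mulrA eI mulrBr mulr1 eI subrr mul0r addr0.
  by [].
move=> i q j; rewrite mxE /= (idxE _ i) // => /= qe; apply: (@spec1 _ q).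
suff <- : to_corner (eI i) (e i) = 1 by [].
by rewrite -(rmorph1 (to_corner (eI i))); apply/to_corner_eq; rewrite mulr1 eI.
Qed.

Lemma nu_lead n (f : itLaurent A n) p : invertible f -> lead p f [ffun j => nu f j 0 p].
Proof.
move=> /is_nu_exists[v fv]; apply: is_nu_lead.
by rewrite /nu; case: xgetP => [w -> //|/(_ v)].
Qed.

End Nu.

(** * Continuous homomorphisms have echelon exponents *)

Section Rays.
Implicit Types n : nat.

Lemma mlastMn n (u : mindex n.+1) k : mlast (u *+ k) = mlast u * k%:Z.
Proof. by rewrite /mlast ffunMnE -mulr_natr natz. Qed.
Lemma mfrontMn n (u : mindex n.+1) k : mfront (u *+ k) = mfront u *+ k.
Proof. by apply/ffunP => j; rewrite !(ffunE, ffunMnE). Qed.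

(** A ray stays in some [Zlam] exactly when its direction is not negative; [ray_Zlam] is the
    converse. If the last coordinate of [u] is positive, each value of it is taken at most once
    along the ray, so the bound can be chosen value by value. *)
Lemma Zlam_ray n (u : mindex n) : ~ lexpos (- u) ->
  exists mu : Lambda n, forall k, Zlam mu (u *+ k).
Proof.
elim: n u => [u _|n IH u]; first by exists tt.
rewrite lexposS mlastN mfrontN => /not_orP[u1 u2].
have [u0|u0] := eqVneq (mlast u) 0.
  have [|mu hmu] := IH (mfront u); first by move=> h; apply: u2; rewrite u0 oppr0.
  by exists (fun=> mu, 0) => k /=; rewrite mlastMn mfrontMn u0 mul0r.
have /choice[mu hmu] : forall j : int, exists mu : Lambda n,
    forall k : nat, mlast u * k%:Z = j -> Zlam mu (mfront u *+ k).
  move=> j; have [[k kj]|nk] := pselect (exists k : nat, mlast u * k%:Z = j).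
    have [mu hmu] := Zlam_pt (mfront u *+ k); exists mu => k'.
    by rewrite -kj => /(mulfI u0)[->].
  by exists (lam0 n) => k kj; case: nk; exists k.
exists (mu, 0) => k /=; rewrite mlastMn mfrontMn; split; last exact: hmu.
by apply: mulr_ge0; lia.
Qed.

Lemma ray_Zlam n (u : mindex n) (lam : Lambda n) :
  (forall k, Zlam lam (u *+ k)) -> ~ lexpos (- u).
Proof.
elim: n u lam => [u lam _ [[]]//|n IH u lam ulam].
rewrite lexposS mlastN mfrontN => -[u1|[u1]].
  have [] := ulam (absz lam.2).+1; rewrite mlastMn => + _.
  have : (absz lam.2).+1%:Z <= - mlast u * (absz lam.2).+1%:Z by apply: ler_peMl; lia.
  by rewrite mulNr; move: (mlast u * _) => x; lia.
have u0 : mlast u = 0 by lia.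
by apply: (IH _ (lam.1 0)) => k; have [_] := ulam k; rewrite mlastMn mfrontMn u0 mul0r.
Qed.

End Rays.

Section WellDefined.
Variables (A : comPzRingType) (n m : nat) (phi : itLaurent A n -> itLaurent A m).
Hypotheses (phiM : monoid_morphism phi) (cphi : tcont phi).

Let phi_inv w : invertible (phi (itmono A w)).
Proof.
have [phi1 phiMM] := phiM.
by exists (phi (itmono A (- w))); rewrite -phiMM -itmonoD subrr itmono0.
Qed.

Section AtPrime.
Variable p : Spec A.

Let V w : mindex m := [ffun j => nu (phi (itmono A w)) j 0 p].

Let V_lead w : lead p (phi (itmono A w)) (V w).
Proof. exact: nu_lead. Qed.

Let VD w w' : V (w + w') = V w + V w'.
Proof.
apply: lead_uniq (V_lead _) _; have [_ phiMM] := phiM.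
by rewrite itmonoD phiMM; exact: leadM.
Qed.

Let V0 : V 0 = 0.
Proof. by apply: (addrI (V 0)); rewrite -VD !addr0. Qed.

Let VN w : V (- w) = - V w.
Proof. by apply: (addrI (V w)); rewrite -VD !subrr V0. Qed.

Let VMn w k : V (w *+ k) = V w *+ k.
Proof. by elim: k => [|k IH]; rewrite ?V0 // !mulrS VD IH. Qed.

(* Were [V w] not positive, the powers [phi(t^w)^k] would all stay outside a
   fixed neighbourhood of zero, whereas the [t^(k w)] tend to zero. *)
Let V_lexpos w : lexpos w -> lexpos (V w).
Proof.
move=> wpos; apply: contrapT => nV.
have [|mu hmu] := @Zlam_ray m (- V w); first by rewrite opprK.
have [lam hlam] := cphi mu.
apply: (@ray_Zlam n (- w) lam); last by rewrite opprK.
move=> k; apply: contrapT => nk; have [pk _] := V_lead (w *+ k).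
apply: pk; have /UnbhsP /(_ _ (hmu k)) : Unbhs mu (phi (itmono A (w *+ k))).
  apply: hlam; apply/UnbhsP => l hl; rewrite itcoef_mono; case: eqP => // e.
  by case: nk; rewrite mulNrn -e opprK.
by rewrite mulNrn opprK -VMn => ->; exact: spec0.
Qed.

(** The pivot of column [i] is the pivot [c i] of the positive vector [V (mdelta i)]. If
    [c i' <= c i] for some [i < i'], the positive vector [mdelta i' - mdelta i *+ N] would have an
    image that is not positive. *)
Lemma hom_Mplus_int :
  Mplus_int (\matrix_(j < m, i < n) nu (phi (itvar A i)) j 0 p).
Proof.
have /choice[c cP] : forall i : 'I_n, lexpos (V (mdelta i)) .
  move=> i; apply: V_lexpos; exists i; rewrite ffunE eqxx; split=> // j ij.
  by rewrite ffunE; case: eqP ij => // ->; rewrite ltnn.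
have xE j i : (\matrix_(j < m, i < n) nu (phi (itvar A i)) j 0 p) j i = V (mdelta i) j.
  by rewrite mxE ffunE itmono_var.
exists c; split=> [i i' ii'|i|i j]; rewrite ?xE; last first.
- by have [_] := cP i; apply.
- by have [] := cP i.
rewrite ltnNge; apply/negP => cc.
have [ci hi] := cP i; have [ci' hi'] := cP i'.
(* The pivot entry of column [i] is at least 1, so this [N] makes the entry of the difference in row
   [c i] negative. *)
pose N := (absz (V (mdelta i') (c i))).+1.
have VE (j : 'I_m) : V (mdelta i' - mdelta i *+ N) j =
    V (mdelta i') j - V (mdelta i) j * N%:Z.
  by rewrite VD VN VMn !(ffunE, ffunMnE) -mulr_natr natz.
have [|j] := @V_lexpos (mdelta i' - mdelta i *+ N).
  exists i'; rewrite !(ffunE, ffunMnE) eqxx; split.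
    by case: eqP ii' => [->|_]; rewrite ?ltnn // mul0rn subr0.
  move=> j i'j; rewrite !(ffunE, ffunMnE).
  case: eqP i'j => [->|_ i'j]; first by rewrite ltnn.
  case: eqP i'j => [-> i'i|_ _]; last by rewrite mul0rn subr0.
  by have := ltn_trans ii' i'i; rewrite ltnn.
rewrite VE => -[jpos j0].
have neg : V (mdelta i') (c i) - V (mdelta i) (c i) * N%:Z < 0.
  have : N%:Z <= V (mdelta i) (c i) * N%:Z by apply: ler_peMl; lia.
  by move: (V (mdelta i) (c i) * _) => x; rewrite /N; lia.
have [jc|cj|/val_inj jc] := ltngtP j (c i).
- by have := j0 _ jc; rewrite VE => e; rewrite e in neg.
- by move: jpos; rewrite (hi _ cj) (hi' j) ?mul0r ?subrr ?ltxx //; exact: leq_ltn_trans cj.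
- by move: jpos; rewrite jc; lia.
Qed.

End AtPrime.

Lemma hom_Hmn : Hmn A m n (fun i => phi (itvar A i)).
Proof.
split=> [i|p]; first by rewrite -itmono_var.
suff -> : map_mx (fun v : Zloc A => v p) (\matrix_(j < m, i < n) nu (phi (itvar A i)) j 0) =
    \matrix_(j < m, i < n) nu (phi (itvar A i)) j 0 p by exact: hom_Mplus_int.
by apply/matrixP => j i; rewrite !mxE.
Qed.

End WellDefined.

(** * Integral powers of invertible series *)

Section Characters.
Variable R : comPzRingType.
Implicit Types (x y : R) (k : int).

(* [y] is meant to be the inverse of [x]. *)
Definition zpow x y k : R := match k with Posz a => x ^+ a | Negz a => y ^+ a.+1 end.

Lemma zpowE x y (a b : nat) : x * y = 1 -> zpow x y (a%:Z - b%:Z) = x ^+ a * y ^+ b.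
Proof.
move=> xy; have [ab|ba] := ltnP a b.
  have -> : a%:Z - b%:Z = Negz (b - a).-1 by lia.
  rewrite /= prednK ?subn_gt0 // -{2}(subnKC (ltnW ab)) exprD mulrA -exprMn xy.
  by rewrite expr1n mul1r.
have -> : a%:Z - b%:Z = Posz (a - b) by lia.
by rewrite /= -{2}(subnK ba) exprD -mulrA -exprMn xy expr1n mulr1.
Qed.

Lemma zpowD x y k k' : x * y = 1 -> zpow x y (k + k') = zpow x y k * zpow x y k'.
Proof.
move=> xy; have split_int (j : int) : exists a b : nat, j = a%:Z - b%:Z.
  by case: j => a; [exists a, 0%N|exists 0%N, a.+1]; lia.
have [a [b ->]] := split_int k; have [a' [b' ->]] := split_int k'.
have -> : a%:Z - b%:Z + (a'%:Z - b'%:Z) = (a + a')%N%:Z - (b + b')%N%:Z by lia.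
by rewrite !zpowE // !exprD mulrACA.
Qed.

Lemma zpowM x y x' y' k : zpow (x * x') (y * y') k = zpow x y k * zpow x' y' k.
Proof. by case: k => a; rewrite /= exprMn. Qed.

(** The character of the lattice with values [x i] on the basis vectors, that is, the prospective
    image of the monomial [t^l]. *)
Definition chr n (x y : 'I_n -> R) (l : mindex n) : R := \prod_i zpow (x i) (y i) (l i).

Lemma chrD n (x y : 'I_n -> R) l l' : (forall i, x i * y i = 1) ->
  chr x y (l + l') = chr x y l * chr x y l'.
Proof.
by move=> xy; rewrite /chr -big_split; apply: eq_bigr => i _; rewrite ffunE zpowD.
Qed.

Lemma chr0 n (x y : 'I_n -> R) : chr x y 0 = 1.
Proof. by rewrite /chr big1 // => i _; rewrite ffunE. Qed.

Lemma chr_delta n (x y : 'I_n -> R) i : chr x y (mdelta i) = x i.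
Proof.
rewrite /chr (bigD1 i) //= ffunE eqxx [zpow _ _ _]expr1 big1 ?mulr1 // => j ji.
by rewrite ffunE (negPf ji).
Qed.

Lemma chrM n (x y x' y' : 'I_n -> R) l :
  chr (fun i => x i * x' i) (fun i => y i * y' i) l = chr x y l * chr x' y' l.
Proof. by rewrite /chr -big_split; apply: eq_bigr => i _; rewrite zpowM. Qed.

Lemma chr_ext n (x y : 'I_n.+1 -> R) l (a : int) : chr x y (mext l a) =
  zpow (x ord_max) (y ord_max) a * chr (x \o lift ord_max) (y \o lift ord_max) l.
Proof.
rewrite /chr (bigD1_ord ord_max) //= ffunE unlift_none; congr (_ * _).
by apply: eq_bigr => i _; rewrite ffunE liftK.
Qed.

(** Agreement on the part cut out by [e] passes to the inverses because
    [e * y i = y i * (e * x' i) * y' i]. *)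
Lemma chr_local n (x y x' y' : 'I_n -> R) e l :
  (forall i, x i * y i = 1) -> (forall i, x' i * y' i = 1) ->
  (forall i, e * x i = e * x' i) -> e * chr x y l = e * chr x' y' l.
Proof.
move=> xy xy' ex.
have exX (a b : R) (k : nat) : e * a = e * b -> e * a ^+ k = e * b ^+ k.
  move=> ab; elim: k => // k IH; by rewrite !exprS mulrA ab mulrAC IH; ring.
have ey i : e * y i = e * y' i.
  have -> : e * y i = y i * (e * x' i) * y' i.
    by rewrite -[LHS]mulr1 -(xy' i); ring.
  by rewrite -ex -[RHS]mulr1 -(xy i); ring.
rewrite /chr; elim/big_rec2: _ => // i a b _ ab.
suff exz : e * zpow (x i) (y i) (l i) = e * zpow (x' i) (y' i) (l i).
  by rewrite mulrA exz mulrAC ab; ring.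
by case: (l i) => k; exact: exX.
Qed.

End Characters.

(** * Families of series with finitely generated coefficients in each degree *)

Section Bounded.
Variable R : comPzRingType.
Implicit Types (f g u : laurent R) (s : seq R).

Lemma zpow_mono (c c' : R) (d k : int) :
  zpow (mono c d) (mono c' (- d)) k = mono (zpow c c' k) (d * k).
Proof.
case: k => a; rewrite /= monoX; congr mono; first by rewrite -mulr_natr natz.
by rewrite NegzE mulrN mulNrn -mulr_natr natz.
Qed.

Lemma chr_mono n (c c' : 'I_n -> R) (d : 'I_n -> int) l :
  chr (fun i => mono (c i) (d i)) (fun i => mono (c' i) (- d i)) l =
  mono (chr c c' l) (\sum_i d i * l i).
Proof.
rewrite /chr; elim/big_rec3: _ => [|i a b z _ ->]; first by rewrite mono1.
by rewrite zpow_mono monoM.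
Qed.

(* Impredicative, so that membership in an open subgroup needs no coefficients. *)
Definition spanned s (x : R) := forall H : R -> Prop, H 0 ->
  (forall a b, H a -> H b -> H (a - b)) -> (forall a, a \in s -> H a) -> H x.

Lemma spanned_sub s s' x : {subset s <= s'} -> spanned s x -> spanned s' x.
Proof. by move=> ss sx H H0 HB Hs; apply: sx => // a /ss; exact: Hs. Qed.

Lemma spanned_mem s x : x \in s -> spanned s x.
Proof. by move=> xs H _ _; exact. Qed.

Lemma spanned0 s : spanned s 0. Proof. by []. Qed.

Lemma spannedD s x y : spanned s x -> spanned s y -> spanned s (x + y).
Proof.
move=> sx sy H H0 HB Hs; rewrite -[y]opprK -[- y]sub0r.
by apply: (HB); [exact: sx|apply: (HB) => //; exact: sy].
Qed.

Lemma spanned_sum (I : eqType) (r : seq I) s (F : I -> R) :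
  (forall i, i \in r -> spanned s (F i)) -> spanned s (\sum_(i <- r) F i).
Proof.
move=> sF; rewrite big_seq; apply: big_ind => //; exact: spannedD.
Qed.

Lemma spannedM s s' x y : spanned s x -> spanned s' y ->
  spanned [seq a * b | a <- s, b <- s'] (x * y).
Proof.
move=> sx sy H H0 HB Hss; apply: (sx (fun x => H (x * y))); first by rewrite mul0r.
  by move=> a b Ha Hb; rewrite mulrBl; exact: HB.
move=> a sa; apply: (sy (fun y => H (a * y))); first by rewrite mulr0.
  by move=> b c Hb Hc; rewrite mulrBr; exact: HB.
by move=> b sb; apply: Hss; apply/allpairsP; exists (a, b).
Qed.

(** A substitute for compactness. The spans are over the integers, so that any subgroup containing
    the generators contains all values; spans over [R] would carry no information, since 1 generates
    everything. *)
Definition bounded_family (I : Type) (F : I -> laurent R) :=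
  (exists D, forall x, below (F x) D) /\
  forall i, exists s, forall x, spanned s (F x i).

Lemma bounded_family_mul I (F G : I -> laurent R) :
  bounded_family F -> bounded_family G -> bounded_family (fun x => F x * G x).
Proof.
move=> [[D FD] /choice[s Fs]] [[D' GD] /choice[s' Gs]].
split=> [|i]; first by exists (D + D') => x; exact: belowM.
pose r := window D (absz (i - D' - D + 1)).
exists (flatten [seq [seq a * b | a <- s j, b <- s' (i - j)] | j <- r]) => x.
have [h|h] := leP D (i - D' + 1).
  rewrite (@lcoefM_window _ _ _ _ _ D (absz (i - D' - D + 1)) i (FD x) (GD x)) //; last lia.
  apply: spanned_sum => j jr; apply: spanned_sub (spannedM (Fs j x) (Gs (i - j) x)).
  by move=> a ha; apply/flattenP; eexists; [apply/mapP; exists j|].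
by rewrite (belowM (FD x) (GD x)) //; lia.
Qed.

Lemma bounded_family_const I f : bounded_family (fun _ : I => f).
Proof.
split=> [|i]; first by have [D fD] := belowP f; exists D.
by exists [:: f i] => _; apply: spanned_mem; rewrite inE.
Qed.

Lemma bounded_family_comp I J (h : I -> J) F : bounded_family F -> bounded_family (F \o h).
Proof.
move=> [[D FD] Fs]; split=> [|i]; first by exists D => x; exact: FD.
by have [s hs] := Fs i; exists s => x; exact: hs.
Qed.

Lemma bounded_family_union I J (F : I -> laurent R) (G : J -> laurent R) :
  bounded_family F -> bounded_family G ->
  bounded_family (fun x : I + J => match x with inl i => F i | inr j => G j end).
Proof.
move=> [[D FD] Fs] [[D' GD] Gs]; split=> [|i].
  by exists (Num.min D D') => -[x|x]; [apply: below_le (FD x)|apply: below_le (GD x)]; lia.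
have [s hs] := Fs i; have [s' hs'] := Gs i; exists (s ++ s') => -[x|x].
  by apply: spanned_sub (hs x) => a; rewrite mem_cat => ->.
by apply: spanned_sub (hs' x) => a; rewrite mem_cat => ->; rewrite orbT.
Qed.

(** In the binomial expansion of [(1 + t) ^+ k] with [t := u - 1], a given degree sees only finitely
    many powers of [t], independently of [k], and these occur with integral multiplicities. *)
Lemma bounded_family_pow u : topnil (u - 1) -> bounded_family (fun k : nat => u ^+ k).
Proof.
set t := u - 1 => tn; have uE (k : nat) : u ^+ k = \sum_(i < k.+1) t ^+ i *+ 'C(k, i).
  rewrite -[u](subrK 1) addrC exprDn_comm; last exact: mulrC.
  by apply: eq_bigr => i _; rewrite expr1n mul1r.
split.
  have [K tK] := topnilX tn 0.
  have [D [D0 tD]] : exists D, D <= 0 /\ forall k : nat, (k < K)%N -> below (t ^+ k) D.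
    elim: K {tK} => [|K [D [D0 tD]]]; first by exists 0.
    have [D' tD'] := belowP (t ^+ K); exists (Num.min D D'); split; first by lia.
    move=> k; rewrite ltnS leq_eqVlt => /orP[/eqP ->|/tD]; first by apply: below_le tD'; lia.
    by apply: below_le; lia.
  exists D => k; rewrite uE; apply: below_sum => i _ j jD; rewrite -mulr_natr.
  rewrite mulr_natr; suff t0 : (t ^+ i) j = 0.
    by elim: 'C(_, _) => // c IH; rewrite mulrS lcoefD t0 IH addr0.
  by have [/tD|/tK] := ltnP i K; apply => //; lia.
move=> j; have [K tK] := topnilX tn (j + 1).
exists [seq (t ^+ i) j | i <- iota 0 K] => k; rewrite uE lcoef_sum.
rewrite -(big_mkord xpredT (fun i => (t ^+ i *+ 'C(k, i)) j)).
apply: spanned_sum => i _; elim: 'C(k, i) => [|c IH]; first exact: spanned0.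
rewrite mulrS lcoefD; apply: spannedD => //; have [iK|Ki] := ltnP i K.
  by apply: spanned_mem; apply/mapP; exists i => //; rewrite mem_iota.
by rewrite tK //; lia.
Qed.

(** Modulo every prime, [u] starts in degree 0 with coefficient 1, hence so does its inverse. *)
Lemma topnil_inv u u' : u * u' = 1 -> topnil (u - 1) -> topnil (u' - 1).
Proof.
move=> uu' un i i0; apply/nilpotentP => p.
have up j : j <= 0 -> p ((u - 1) j) by move=> /un /nilpotentP.
have [k [uk u'k xk pk]] := unit_lowest p uu'.
have u0 : ~ p (u 0).
  move=> p0; have := up 0 (lexx 0); rewrite lcoefB lcoef1 eqxx => /specBr/(_ p0).
  exact: spec1.
have k0 : k = 0.
  apply/eqP; rewrite eq_le; apply/andP; split; rewrite leNgt; apply/negP => k0.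
    by apply: u0; exact: uk.
  by have := up k (ltW k0); rewrite lcoefB lcoef1 lt_eqF // subr0.
rewrite k0 oppr0 in u'k xk; move: i0; rewrite le_eqVlt => /orP[/eqP ->|i0].
  rewrite lcoefB lcoef1 eqxx.
  have -> : u' 0 - 1 = (u 0 * u' 0 - 1) - (u 0 - 1) * u' 0 by ring.
  by apply: specB => //; apply: specMr; have := up 0 (lexx 0); rewrite lcoefB lcoef1 eqxx.
by rewrite lcoefB lcoef1 lt_eqF // subr0; exact: u'k.
Qed.

Lemma bounded_family_chr n (u u' : 'I_n -> laurent R) :
  (forall i, u i * u' i = 1) -> (forall i, topnil (u i - 1)) ->
  bounded_family (chr u u').
Proof.
move=> uu' un; suff h r : bounded_family (fun l : mindex n =>
    \prod_(i <- r) zpow (u i) (u' i) (l i)) by exact: h.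
elim: r => [|i r IH].
  rewrite (_ : (fun l => _) = (fun=> 1)); last by apply: funext => l; rewrite big_nil.
  exact: bounded_family_const.
rewrite (_ : (fun l => _) =
    (fun l : mindex n => zpow (u i) (u' i) (l i) * \prod_(i <- r) zpow (u i) (u' i) (l i))); last first.
  by apply: funext => l; rewrite big_cons.
apply: bounded_family_mul => //.
have := bounded_family_union (bounded_family_pow (un i))
  (bounded_family_pow (topnil_inv (uu' i) (un i))).
move=> /(bounded_family_comp (fun l : mindex n =>
  match l i with Posz a => inl a | Negz a => inr a.+1 end)).
rewrite (_ : _ \o _ = fun l : mindex n => zpow (u i) (u' i) (l i)) //.
by apply: funext => l /=; rewrite /zpow; case: (l i).
Qed.

End Bounded.

(** * Convergence for echelon exponents *)

Section Estimate.
Variable A : comPzRingType.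
Implicit Types n m : nat.

Definition comb n m (v : 'I_n -> mindex m) (w : mindex n) : mindex m :=
  [ffun j => \sum_i v i j * w i].

Definition lex_increasing n m (v : 'I_n -> mindex m) :=
  forall w, lexpos w -> lexpos (comb v w).

Lemma comb_delta n m (v : 'I_n -> mindex m) i : comb v (mdelta i) = v i.
Proof.
apply/ffunP => j; rewrite ffunE (bigD1 i) //= ffunE eqxx mulr1 big1 ?addr0 // => k ki.
by rewrite ffunE (negPf ki) mulr0.
Qed.

Lemma mlast_comb n m (v : 'I_n -> mindex m.+1) w :
  mlast (comb v w) = \sum_i mlast (v i) * w i.
Proof. by rewrite /mlast ffunE. Qed.

Lemma mfront_comb n m (v : 'I_n -> mindex m.+1) w :
  mfront (comb v w) = comb (fun i => mfront (v i)) w.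
Proof. by apply/ffunP => j; rewrite !ffunE; apply: eq_bigr => i _; rewrite ffunE. Qed.

Lemma comb_ext n m (v : 'I_n.+1 -> mindex m) w a : comb v (mext w a) =
  [ffun j => v ord_max j * a + comb (v \o lift ord_max) w j].
Proof.
apply/ffunP => j; rewrite !ffunE (bigD1_ord ord_max) //= ffunE unlift_none.
by congr (_ + _); apply: eq_bigr => i _; rewrite ffunE liftK.
Qed.

Lemma lexpos_delta n (i : 'I_n) : lexpos (mdelta i).
Proof.
exists i; rewrite ffunE eqxx; split=> // j ij.
by rewrite ffunE; case: eqP ij => // ->; rewrite ltnn.
Qed.

(** If [i] is the pivot of [w], then [p i] is the pivot of the combination: earlier columns vanish
    from row [p i] on, and later columns have coefficient zero. *)
Lemma Mplus_int_lex m n (x : 'M[int]_(m, n)) :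
  Mplus_int x -> lex_increasing (fun i => [ffun j => x j i]).
Proof.
move=> [p [pmono ppos p0]] w [i [wi wi0]]; exists (p i); split.
  rewrite ffunE (bigD1 i) //= ffunE big1 ?addr0; first by rewrite mulr_gt0.
  move=> k ki; rewrite ffunE; have [ki'|ik|/val_inj/eqP] := ltngtP k i.
  - by rewrite p0 ?mul0r //; exact: pmono.
  - by rewrite wi0 ?mulr0.
  - by rewrite (negPf ki).
move=> j pij; rewrite ffunE big1 // => k _; rewrite ffunE.
have [ki|ik] := leqP k i; last by rewrite wi0 ?mulr0.
rewrite p0 ?mul0r //; apply: leq_ltn_trans pij.
move: ki; rewrite leq_eqVlt => /orP[/eqP/val_inj -> //|/pmono]; exact: ltnW.
Qed.

(* Comparing [t_n] with arbitrary powers of [t_i], [i < n]. *)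
Lemma lex_increasing_mlast n m (v : 'I_n.+1 -> mindex m.+1) : lex_increasing v ->
  0 <= mlast (v ord_max) /\ forall i, mlast (v (lift ord_max i)) = 0.
Proof.
move=> vlex.
have ge0 w : lexpos w -> 0 <= mlast (comb v w).
  by move=> /vlex; rewrite lexposS => -[|[->]] // /ltW.
have d0 i : 0 <= mlast (v i) by rewrite -(comb_delta v); apply/ge0/lexpos_delta.
split=> // i; apply/eqP; rewrite eq_le d0 andbT.
pose N : int := mlast (v ord_max) + 1.
have := ge0 (mext [ffun j => - N * (j == i)%:R] 1).
rewrite lexposS mlast_ext => /(_ (or_introl ltr01)).
rewrite comb_ext /mlast !ffunE mulr1 (bigD1 i) //= ffunE eqxx mulr1 big1 ?addr0; last first.
  by move=> k ki; rewrite ffunE (negPf ki) !mulr0.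
have := d0 ord_max; rewrite -/(mlast (v ord_max)) -/(mlast (v (lift ord_max i))) /N => h.
rewrite leNgt => h'; apply/negP => pos; move/negP: h'; apply.
have : mlast (v ord_max) + 1 <= mlast (v (lift ord_max i)) * (mlast (v ord_max) + 1).
  by apply: ler_peMl; lia.
by rewrite mulrN; move: (_ * (_ + 1)) => y; lia.
Qed.

(** For fixed [l] the elements [a] with [C l * a] in [Unbhs mu] form a subgroup, so an exceptional
    [l] for [h] is exceptional for one of the finitely many generators. *)
Lemma spanned_finite (I : Type) m (P : set I) (mu : Lambda m) (C h : I -> itLaurent A m)
    (s : seq (itLaurent A m)) :
  (forall a, a \in s -> finite_set [set l | P l /\ ~ Unbhs mu (C l * a)]) ->
  (forall l, spanned s (h l)) -> finite_set [set l | P l /\ ~ Unbhs mu (C l * h l)].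
Proof.
move=> sfin hs; apply: (@sub_finite_set _ _ (\bigcup_(a in [set` s])
    [set l | P l /\ ~ Unbhs mu (C l * a)])); last first.
  by apply: bigcup_finite; [exact: finite_seq|exact: sfin].
move=> l [Pl nU]; apply: contrapT => nl; apply: nU.
apply: (hs l (fun a => Unbhs mu (C l * a))).
- by rewrite mulr0; exact: Unbhs0.
- by move=> a b Ha Hb; rewrite mulrBr; exact: UnbhsB.
by move=> a sa; apply: contrapT => na; apply: nl; exists a.
Qed.

(** [Unbhs mu] imposes conditions in degrees at most [- mu.2] only, and below [D] the series vanish;
    finitely many slices remain. *)
Lemma spanned_finite_slices (I : Type) m (P : set I) (mu : Lambda m.+1) (D : int)
    (F : I -> itLaurent A m.+1) (C : I -> itLaurent A m)
    (h : I -> int -> itLaurent A m) (s : int -> seq (itLaurent A m)) :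
  (forall l i, sl (F l) i = C l * h l i) ->
  (forall l i, P l -> i < D -> h l i = 0) -> (forall l i, spanned (s i) (h l i)) ->
  (forall i a, finite_set [set l | P l /\ ~ Unbhs (mu.1 i) (C l * a)]) ->
  finite_set [set l | P l /\ ~ Unbhs mu (F l)].
Proof.
move=> FE hD hs Cfin.
apply: (@sub_finite_set _ _ (\bigcup_(i in [set i : int | mu.2 <= i < - D + 1])
    [set l | P l /\ ~ Unbhs (mu.1 i) (C l * h l (- i))])); last first.
  apply: bigcup_finite; first exact: finite_int_interval.
  by move=> i _; apply: (spanned_finite (s := s (- i))) => // a _; exact: Cfin.
move=> l [Pl nU]; apply: contrapT => nl; apply: nU; apply/UnbhsS => i mui.
rewrite FE; have [iD|Di] := ltP (- i) D; first by rewrite hD // mulr0; exact: Unbhs0.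
by apply: contrapT => nU; apply: nl; exists i => //=; lia.
Qed.

(** Each [x i] is its leading monomial [t (c i) (d i)] in the last variable times a unit [u i] with
    [u i - 1] topologically nilpotent. Among the [d i] only the last can be nonzero, so the image of
    [t^l] is [C l] times a bounded family, shifted by [d ord_max * mlast l]. Thus the question
    descends to the units [c i] of the smaller ring. *)
Lemma chr_adm n m (x y : 'I_n -> itLaurent A m) (v : 'I_n -> mindex m) :
  (forall i, x i * y i = 1) -> (forall i, good (v i) (x i)) -> lex_increasing v ->
  adm (chr x y).
Proof.
elim: m n x y v => [|m IH] [|n] x y v xy xgood vlex lam mu.
- by apply: (@sub_finite_set _ _ [set 0]) => // l _; exact: mindex0_eq.
- by have [[]] := vlex _ (lexpos_delta ord0).
- by apply: (@sub_finite_set _ _ [set 0]) => // l _; exact: mindex0_eq.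
pose d i := mlast (v i); have [dn0 dl0] := lex_increasing_mlast vlex.
pose c i : itLaurent A m := sl (x i) (d i).
have cgood i : good (mfront (v i)) (c i) by have [] := xgood i.
have /choice[c' cc'] i := good_invertible (cgood i).
pose t a j : itLaurent A m.+1 := @mono (itL A m) a j.
have tt' i : t (c i) (d i) * t (c' i) (- d i) = 1.
  by rewrite /t; have := @monoM (itL A m) (c i) (c' i) (d i) (- d i); rewrite subrr cc' mono1.
pose u i : itLaurent A m.+1 := t (c' i) (- d i) * x i.
pose u' i : itLaurent A m.+1 := t (c i) (d i) * y i.
have uu' i : u i * u' i = 1.
  rewrite /u /u'; have -> : t (c' i) (- d i) * x i * (t (c i) (d i) * y i) =
    t (c i) (d i) * t (c' i) (- d i) * (x i * y i) by ring.
  by rewrite tt' xy mulr1.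
have utop i : @topnil (itL A m) (u i - 1).
  move=> j j0; rewrite lcoefB /u /t [X in X - _](@lcoef_monoM (itL A m)) opprK lcoef1.
  have [_ nil _] := xgood i.
  move: j0; rewrite le_eqVlt => /orP[/eqP ->|j0].
    rewrite eqxx add0r; exists 1%N; rewrite expr1.
    by have := cc' i; rewrite mulrC => e; apply/eqP; rewrite subr_eq0; apply/eqP.
  rewrite lt_eqF // subr0; have [k xk] : nilpotent (sl (x i) (j + d i)).
    by apply: nil; rewrite /d; lia.
  exists k; rewrite exprMn; have -> : (x i : laurent (itL A m)) (j + d i) ^+ k = 0 := xk.
  by rewrite mulr0.
have [[D uD] /choice[s us]] := @bounded_family_chr (itL A m) _ u u' uu' utop.
pose C := chr c c'; pose U : mindex n.+1 -> itLaurent A m.+1 := chr u u'.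
have dl (l : mindex n.+1) : \sum_i d i * l i = d ord_max * mlast l.
  by rewrite (bigD1_ord ord_max) //= big1 ?addr0 // => i _; rewrite /d dl0 mul0r.
have slE l j : sl (chr x y l) j = C l * sl (U l) (j - d ord_max * mlast l).
  have -> : chr x y l = t (C l) (\sum_i d i * l i) * U l.
    have -> : t (C l) (\sum_i d i * l i) =
        chr (fun i => t (c i) (d i)) (fun i => t (c' i) (- d i)) l.
      exact: (esym (@chr_mono (itL A m) _ c c' d l)).
    rewrite /U -(@chrM (itLaurent A m.+1)); apply: eq_bigr => i _.
    congr zpow; first by rewrite mulrA tt' mul1r.
    by rewrite mulrA [_ * t (c i) _]mulrC tt' mul1r.
  by rewrite -dl; exact: (@lcoef_monoM (itL A m)).
(* Without a shift, the exponents of all the [c i] are still increasing in the smaller ring, and the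
   induction hypothesis applies to the whole of [C]. *)
have [dn|dn] := eqVneq (d ord_max) 0.
  have aC : adm C.
    apply: (IH _ _ _ (fun i => mfront (v i))) => // w /vlex.
    rewrite lexposS mlast_comb mfront_comb; under eq_bigr do rewrite -/(d _).
    by rewrite dl dn mul0r ltxx => -[//|[]].
  apply: (@spanned_finite_slices _ _ _ mu D _ C (fun l j => sl (U l) j) s) => [l j|l j _|l j|i a].
  - by rewrite slE dn mul0r subr0.
  - exact: uD.
  - exact: us.
  - have := adm_mul a aC lam (mu.1 i); apply: sub_finite_set => l [Pl nU].
    by split=> //; rewrite mulrC.
(* With a positive shift, only the first [n] of the [c i] keep increasing exponents. The last
   coordinate of [l] is bounded below by [lam] and, for the exceptional [l], above through the
   shift, so each of its finitely many values [a] is treated separately. *)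
have d_gt0 : 0 < d ord_max by rewrite lt_def dn.
have aC a : adm (fun l => C (mext l a)).
  have aC' : adm (chr (c \o lift ord_max) (c' \o lift ord_max)).
    apply: (IH _ _ _ (fun i => mfront (v (lift ord_max i)))) => [i|i|w wpos] //=.
    have : lexpos (comb v (mext w 0)).
      by apply: vlex; rewrite lexposS mlast_ext mfront_ext; right.
    rewrite lexposS mlast_comb; under eq_bigr do rewrite -/(d _).
    rewrite dl mlast_ext mulr0 ltxx => -[//|[_]].
    congr lexpos; rewrite comb_ext; apply/ffunP => j; rewrite !ffunE mulr0 add0r.
    by apply: eq_bigr => i _; rewrite ffunE.
  move=> lam' mu'; have := adm_mul (zpow (c ord_max) (c' ord_max) a) aC' lam' mu'.
  by apply: sub_finite_set => l /=; rewrite /C chr_ext.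
(* The series for [l] starts no lower than [D + d ord_max * mlast l]; once this exceeds [- mu.2], it
   meets no condition of [Unbhs mu]. *)
have [b bP] : exists b : int, forall (l : mindex n.+1) (i : int),
    mu.2 <= i -> D <= - i - d ord_max * mlast l -> mlast l < b.
  exists (`|mu.2 + D| + 1) => l i hi hD; rewrite ltNge; apply/negP => hb.
  have : mlast l <= d ord_max * mlast l by apply: ler_peMl; lia.
  by move: hD; move: (d ord_max * mlast l) => z; lia.
apply: (@sub_finite_set _ _ (\bigcup_(a in [set a : int | lam.2 <= a < b])
    [set mext l a | l in [set l | Zlam (lam.1 a) l /\ ~ Unbhs mu (chr x y (mext l a))]])).
  move=> l [[hl hl'] nU]; exists (mlast l) => /=; last first.
    by exists (mfront l); rewrite ?mext_eta.
  rewrite hl ltNge; apply/negP => bl; apply: nU; apply/UnbhsS => i mui.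
  rewrite slE [sl _ _](uD l) ?mulr0; first exact: Unbhs0.
  by rewrite ltNge; apply/negP => /(bP l i mui); rewrite ltNge bl.
apply: bigcup_finite; first exact: finite_int_interval.
move=> a _; apply: finite_image.
apply: (@spanned_finite_slices _ _ _ mu (D + d ord_max * a) _ (fun l => C (mext l a))
  (fun l j => sl (U (mext l a)) (j - d ord_max * a)) (fun j => s (j - d ord_max * a)))
  => [l j|l j _ jD|l j|i a'].
- by rewrite slE mlast_ext.
- by apply: (uD (mext l a)); lia.
- exact: us.
- have := adm_mul a' (aC a) (lam.1 a) (mu.1 i); apply: sub_finite_set => l [Pl nU].
  by split=> //; rewrite mulrC.
Qed.

End Estimate.

(** * The bijection *)

Lemma mindex_generated n (P : mindex n -> Prop) :
  P 0 -> (forall a b, P a -> P b -> P (a - b)) -> (forall i, P (mdelta i)) -> forall l, P l.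
Proof.
move=> P0 PB Pd l.
have PN a : P a -> P (- a) by rewrite -sub0r; exact: PB.
have PD a b : P a -> P b -> P (a + b) by move=> Pa /PN; rewrite -{2}[b]opprK; exact: PB.
have PMn a k : P a -> P (a *+ k).
  by move=> Pa; elim: k => // k IH; rewrite mulrS; exact: PD.
have deltaE (i j : 'I_n) k : (mdelta i *~ k) j = (j == i)%:R * k.
  case: k => k; first by rewrite -pmulrn ffunMnE ffunE natz -mulr_natr natz.
  by rewrite NegzE mulrNz -pmulrn ffunE ffunMnE ffunE natz -mulr_natr natz mulrN.
have -> : l = \sum_i (mdelta i *~ l i).
  apply/ffunP => j; rewrite sum_ffunE (bigD1 j) //= deltaE eqxx mul1r big1 ?addr0 // => i ij.
  by rewrite deltaE eq_sym (negPf ij) mul0r.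
by apply: big_ind => // i _; case: (l i) => k; [|apply: PN]; exact: PMn.
Qed.

Lemma HomCAlg_inj A n m : {in HomCAlg A n m &, injective
  (fun (phi : itLaurent A n -> itLaurent A m) (i : 'I_n) => phi (itvar A i))}.
Proof.
have hom phi : HomCAlg A n m phi ->
    [/\ zmod_morphism phi, forall a f, phi (a *: f) = a *: phi f & tcont phi].
  move=> [lphi _ cphi]; have aphi : zmod_morphism phi.
    by move=> x y; rewrite -scaleN1r addrC lphi addrC scaleN1r.
  split=> // [a f|]; last exact/tcont_continuous.
  by rewrite -[a *: f]addr0 lphi (zmod_morphismD aphi).1 addr0.
move=> phi psi /set_mem hphi /set_mem hpsi e; apply: funext.
have [aphi sphi cphi] := hom _ hphi; have [apsi spsi cpsi] := hom _ hpsi.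
have [_ [phi1 phiM] _] := hphi; have [_ [psi1 psiM] _] := hpsi.
apply: tcont_ext => // a l; rewrite sphi spsi; congr (_ *: _); move: l.
apply: mindex_generated => [|l l' hl hl'|i].
- by rewrite itmono0 phi1 psi1.
- rewrite itmonoD phiM psiM hl; congr (_ * _).
  rewrite -[LHS]mulr1 -psi1 -(itmono0 A) -(subrr l') itmonoD psiM -hl' mulrA -phiM -itmonoD.
  by rewrite addNr itmono0 phi1 mul1r.
- by rewrite itmono_var; exact: (congr1 (fun h => h i) e).
Qed.

(** Only the convergence of the family [chr f g] is at stake, and the scalars [a] for which its
    multiple by [a] converges form an ideal. Near a prime [p] the product [E] of idempotents makes
    every [f i] agree with a good series whose exponent is [nu (f i)] at [p], so that [chr_adm]
    applies. *)
Lemma Hmn_hom A n m (f : 'I_n -> itLaurent A m) : Hmn A m n f ->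
  exists2 phi, HomCAlg A n m phi & forall i, phi (itvar A i) = f i.
Proof.
move=> [finv fM]; have /choice[g fg] := finv.
have admf : adm (fun l => itconst m 1 * chr f g l).
  apply: (@ideal_one A (fun a => adm (fun l => itconst m a * chr f g l))).
    split.
    - move=> lam mu; have := @adm_zero A n m lam mu; apply: sub_finite_set => l /=.
      by rewrite rmorph0 mul0r.
    - move=> a b ha hb lam mu; have := adm_add ha hb lam mu; apply: sub_finite_set => l /=.
      by rewrite rmorphD mulrDl.
    - move=> r a ha lam mu; have := adm_mul (itconst m r) ha lam mu.
      by apply: sub_finite_set => l /=; rewrite rmorphM mulrA.
  move=> p.
  have /choice[e he] := fun i => invertible_good p (finv i).
  have /choice[v hv] := he; have {hv} /choice[h hh] := hv.
  have /choice[h' hh'] : forall i, exists y, h i * y = 1.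
    by move=> i; have [_ _ /good_invertible] := hh i.
  pose E := \prod_i e i; exists E; last first.
    rewrite /E; elim/big_rec: _ => [|i x _ px]; first exact: spec1.
    by have [_ pei _ _] := hh i; case/specM.
  have Ef i : itconst m E * f i = itconst m E * h i.
    have [_ _ _ eh] := hh i.
    by rewrite /E (bigD1 i) //= [e i * _]mulrC rmorphM -!mulrA eh.
  have vE i : v i = [ffun j => nu (f i) j 0 p].
    apply: lead_uniq (nu_lead p (finv i)); have [_ pei hg eh] := hh i.
    exact: lead_local pei eh (good_lead p hg).
  move=> lam mu; have := @adm_mul A n m (itconst m E) (chr h h') _ lam mu.
  have /[swap]/[apply] : adm (chr h h').
    apply: (chr_adm (v := v)) => // [i|]; first by have [] := hh i.
    rewrite (_ : v = fun i => [ffun j =>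
      map_mx (fun z : Zloc A => z p) (\matrix_(j < m, i < n) nu (f i) j 0) j i]).
      exact/Mplus_int_lex/fM.
    by apply: funext => i; rewrite vE; apply/ffunP => j; rewrite !ffunE !mxE.
  by apply: sub_finite_set => l /=; rewrite (chr_local l fg hh' Ef).
have admf' : adm (chr f g).
  move=> lam mu; have := admf lam mu; apply: sub_finite_set => l /=.
  by rewrite rmorph1 mul1r.
have [|l l'|phi [lphi mphi cphi phiE]] := adm_morph admf'.
- exact: chr0.
- exact: chrD.
exists phi; last by move=> i; rewrite -itmono_var phiE chr_delta.
split=> //; apply/tcont_continuous => //.
by move=> x y; rewrite -scaleN1r addrC lphi addrC scaleN1r.
Qed.

Theorem theorem4p7 (A : comPzRingType) (m n : nat) (hm : (1 <= m)%N) (hn : (1 <= n)%N) :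
  set_bij (HomCAlg A n m) (Hmn A m n)
    (fun (phi : itLaurent A n -> itLaurent A m) (i : 'I_n) => phi (itvar A i)).
Proof.
split.
- move=> phi [lphi mphi cphi]; apply: hom_Hmn => //; apply/tcont_continuous => //.
  by move=> x y; rewrite -scaleN1r addrC lphi addrC scaleN1r.
- exact: HomCAlg_inj.
- move=> f /Hmn_hom[phi hphi phiE]; exists phi => //.
  by apply: funext.
Qed.
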